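(* Over any finite field $F$ there exists an infinite, finitely generated, recursively presented, residually finite associative algebra $A$ with unity such that all finite Cartesian powers of $A$ are algorithmically finite, i.e., for every positive integer $n$ there is no algorithm that writes out an infinite sequence of pairwise different elements of the algebra $A^n$. Moreover, the algebra $A$ is generated by a finite set of nilpotent elements.
   Context: For a finite set $X$, $F\langle X\rangle$ denotes the free associative algebra with unity over $F$ with basis $X$ (polynomials in the non-commuting variables $X$ with coefficients in $F$). ''Generated'' means generated as an algebra with unity. A finitely generated algebra $A$ with unity over the finite field $F$ is recursively presented if $A\cong F\langle X\rangle/(R)$ for some finite set $X$ and some recursively enumerable subset $R\subseteq F\langle X\rangle$, where $(R)$ is the two-sided ideal generated by $R$. The algebra $A$ is residually finite if for every nonzero $a\in A$ there is a homomorphism from $A$ to a finite algebra that does not send $a$ to zero. Elements of $A^n$ are represented by $n$-tuples of elements of $F\langle X\rangle$, and an algorithm that writes out an infinite sequence of pairwise different elements of $A^n$ means a programme with no input that outputs an infinite sequence of $n$-tuples of elements of $F\langle X\rangle$ whose images in $A^n$ are pairwise different. *)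

(* Defs.v *)
From HB Require Import structures.
From mathcomp Require Import all_boot all_algebra.
From mathcomp Require Import monalg.
From Stdlib Require Cantor.

Set Implicit Arguments.
Unset Strict Implicit.
Unset Printing Implicit Defensive.

Import GRing.Theory.
Local Open Scope ring_scope.

(* The Cantor bijection between nat * nat and nat. *)
Definition npair (a b : nat) : nat := Cantor.to_nat (a, b).
Definition nleft (k : nat) : nat := (Cantor.of_nat k).1.
Definition nright (k : nat) : nat := (Cantor.of_nat k).2.

(* Programmes for partial recursive functions in one variable, several
   arguments being passed through npair. The identity is
   PPair PLeft PRight. *)
Inductive program : Type :=
| PZero
| PSucc
| PLeft
| PRight
| PPair of program & program
| PComp of program & program
| PRec of program & program
| PMu of program.

(* outputs c x y: the programme c halts on the input x with the output y.
   PRec f g is primitive recursion on the right component of the input, and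
   PMu f maps a to the least k such that f (a, k) = 0, provided that f halts
   on (a, j) for all j < k. *)
Inductive outputs : program -> nat -> nat -> Prop :=
| outputs_zero x : outputs PZero x 0
| outputs_succ x : outputs PSucc x x.+1
| outputs_left x : outputs PLeft x (nleft x)
| outputs_right x : outputs PRight x (nright x)
| outputs_pair f g x y z :
    outputs f x y -> outputs g x z -> outputs (PPair f g) x (npair y z)
| outputs_comp f g x y z :
    outputs g x y -> outputs f y z -> outputs (PComp f g) x z
| outputs_rec0 f g a y :
    outputs f a y -> outputs (PRec f g) (npair a 0) y
| outputs_recS f g a k y z :
    outputs (PRec f g) (npair a k) y ->
    outputs g (npair a (npair k y)) z ->
    outputs (PRec f g) (npair a k.+1) z
| outputs_mu f a k (v : nat -> nat) :
    (forall j, (j < k)%N -> outputs f (npair a j) (v j).+1) ->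
    outputs f (npair a k) 0 ->
    outputs (PMu f) a k.

(* A bijection from nat to seq nat: 0 is the code of [::], and (npair h t).+1
   that of h :: s, where t is the code of s. The codes of tails decrease, so
   that k steps are enough to decode k. *)
Fixpoint decode_rec (steps k : nat) : seq nat :=
  match steps, k with
  | steps'.+1, k'.+1 => nleft k' :: decode_rec steps' (nright k')
  | _, _ => [::]
  end.
Definition decode_seq (k : nat) : seq nat := decode_rec k k.

(* The free associative algebra with unity over F on m generators. *)
Notation free_alg F m := {malg F[{fmonom 'I_m}]}.

Section Decoding.
Variables (F : finFieldType) (m : nat).

(* The enumeration of F is an arbitrary one; since F is finite, computability
   does not depend on it. Letters that are not smaller than m are skipped. *)
Definition decode_coef (k : nat) : F := nth 0 (enum F) k.
Definition decode_word (k : nat) : {fmonom 'I_m} :=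
  FMonom (pmap insub (decode_seq k)).

(* A surjection from nat onto F<X>: k is the code of a list of codes of
   pairs (coefficient, word), which stands for the sum of these terms. *)
Definition decode_poly (k : nat) : free_alg F m :=
  \sum_(t <- decode_seq k) << decode_coef (nleft t) *g decode_word (nright t) >>.

Definition decode_tuple (n k : nat) : {ffun 'I_n -> free_alg F m} :=
  [ffun i : 'I_n => decode_poly (nth 0%N (decode_seq k) i)].

(* R is the set of all outputs of some programme. *)
Definition recursively_enumerable (R : free_alg F m -> Prop) : Prop :=
  exists c : program,
    forall p, R p <-> exists x y, outputs c x y /\ decode_poly y = p.

Definition computable_sequence n (u : nat -> {ffun 'I_n -> free_alg F m}) : Prop :=
  exists c : program,
    forall k, exists y, outputs c k y /\ decode_tuple n y = u k.

Inductive ideal_generated (R : free_alg F m -> Prop) : free_alg F m -> Prop :=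
| ideal_gen p : R p -> ideal_generated R p
| ideal_zero : ideal_generated R 0
| ideal_add p q :
    ideal_generated R p -> ideal_generated R q -> ideal_generated R (p + q)
| ideal_mull p q : ideal_generated R q -> ideal_generated R (p * q)
| ideal_mulr p q : ideal_generated R p -> ideal_generated R (p * q).

Variable A : algType F.

(* phi induces an isomorphism from F<X>/(R) onto A, for some recursively
   enumerable R. *)
Definition recursive_presentation (phi : {lrmorphism free_alg F m -> A}) : Prop :=
  (forall a, exists p, phi p = a) /\
  exists R : free_alg F m -> Prop,
    recursively_enumerable R /\ forall p, phi p = 0 <-> ideal_generated R p.

(* Elements of the n-th Cartesian power of A are represented by n-tuples of
   elements of F<X> through phi. *)
Definition algorithmically_finite_power
    (phi : {lrmorphism free_alg F m -> A}) (n : nat) : Prop :=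
  ~ exists u : nat -> {ffun 'I_n -> free_alg F m},
      computable_sequence u /\
      injective (fun k => [ffun i => phi (u k i)] : {ffun 'I_n -> A}).

End Decoding.

Section Algebras.
Variables (F : finFieldType) (A : algType F).

Definition infinite_algebra : Prop := ~ exists s : seq A, forall a, a \in s.

Definition residually_finite : Prop :=
  forall a : A, a != 0 ->
    exists (B : finAlgType F) (f : {lrmorphism A -> B}), f a != 0.

Definition nilpotent_elt (a : A) : Prop := exists k : nat, a ^+ k = 0.

Inductive subalgebra_generated (s : seq A) : A -> Prop :=
| subalg_gen a : a \in s -> subalgebra_generated s a
| subalg_one : subalgebra_generated s 1
| subalg_add a b :
    subalgebra_generated s a -> subalgebra_generated s b ->
    subalgebra_generated s (a + b)
| subalg_scale (c : F) a :
    subalgebra_generated s a -> subalgebra_generated s (c *: a)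
| subalg_mul a b :
    subalgebra_generated s a -> subalgebra_generated s b ->
    subalgebra_generated s (a * b).

End Algebras.

(* Main.v *)
Require Import Defs.
From HB Require Import structures.
From mathcomp Require Import all_boot all_algebra.
From mathcomp Require Import monalg.
From mathcomp Require Import boolp generic_quotient zify.
From Stdlib Require Cantor.

Set Implicit Arguments.
Unset Strict Implicit.
Unset Printing Implicit Defensive.

Import GRing.Theory.

(** The algebra is a graded Golod-Shafarevich quotient of F<x_1, ..., x_8> by
    the powers x_i^4 and by relators that defeat every pair (programme e, n).
    As F is finite, there are only finitely many n-tuples modulo terms of degree
    at least d, so a programme that writes out n-tuples forever writes out two,
    u_i and u_j with i <> j, that agree below degree d; the homogeneous
    components of the coordinates of u_i - u_j are taken as relators, for the
    first such coincidence found in an enumeration of computation certificates.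
    The bound d = d(e, n) is chosen so large that there are at most k of these
    relators in degree k. Then the dimensions of the homogeneous components of
    the quotient at least double from one degree to the next, so the quotient is
    infinite, and it is residually finite because it is graded with finite
    components. *)

(** * Computable functions *)

(** The constants come from the following balance. If dimensions at least double in each step, then,
    in passing from degree k to k+1, a relator of degree j+1 costs at most the fraction 2^(-j) of
    the dimension in degree k. With j+1 such relators these fractions sum to at most 4, and the
    eight fourth powers add 8/2^3 = 1. The total 5 is below 8 - 2, so a factor 2 of growth survives.
    Since F is finite, a component is measured by the cardinality of its dual, the forms on words of
    length k that vanish on the ideal. The estimates become multiplicative, and no basis of the
    quotient is needed. Halting is undecidable, but checking a certificate is a total computation.
    So the search for a coincidence is a legitimate enumeration, and a pair (e, n) whose search
    never ends yields no relators. Components are imposed, rather than the differences themselves,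
    because only homogeneous relators give a grading, on which both the count and the finite
    quotients rest. *)

Lemma nleftK a b : nleft (npair a b) = a.
Proof. by rewrite /nleft /npair Cantor.cancel_of_to. Qed.

Lemma nrightK a b : nright (npair a b) = b.
Proof. by rewrite /nright /npair Cantor.cancel_of_to. Qed.

Lemma npairK k : npair (nleft k) (nright k) = k.
Proof.
by rewrite /npair /nleft /nright -[RHS]Cantor.cancel_to_of; case: Cantor.of_nat.
Qed.

Lemma nright_le k : nright k <= k.
Proof.
rewrite -{2}(npairK k); apply/leP.
have := Cantor.to_nat_non_decreasing (nleft k) (nright k).
by apply: PeanoNat.Nat.le_trans; apply: PeanoNat.Nat.le_add_r.
Qed.

Definition encode_seq (s : seq nat) : nat :=
  foldr (fun h t => (npair h t).+1) 0 s.

Lemma decode_rec_steps n k : k <= n -> decode_rec n k = decode_rec k k.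
Proof.
elim/ltn_ind: k n => -[|k] IH [|n] //=; rewrite ltnS => le_kn.
have le_rk := nright_le k.
by rewrite IH ?[in RHS]IH // (leq_trans le_rk).
Qed.

Lemma decode_seqS k : decode_seq k.+1 = nleft k :: decode_seq (nright k).
Proof. by rewrite /decode_seq /= decode_rec_steps ?nright_le. Qed.

Lemma encode_seqK : cancel encode_seq decode_seq.
Proof. by elim=> [|h t IH] //=; rewrite decode_seqS nleftK nrightK IH. Qed.

Lemma decode_seqK : cancel decode_seq encode_seq.
Proof.
elim/ltn_ind=> -[|k] IH //; rewrite decode_seqS /= IH ?npairK //.
by rewrite ltnS nright_le.
Qed.

(** Only total functions are meant; the one unbounded search is added later, by a single [PMu] over
    a computable test. *)
Definition computable (f : nat -> nat) : Prop :=
  exists c, forall x, outputs c x (f x).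

Definition computable_seq (s : nat -> seq nat) : Prop :=
  computable (fun x => encode_seq (s x)).

Lemma computable_ext f g : f =1 g -> computable f -> computable g.
Proof. by move=> fg [c cP]; exists c => x; rewrite -fg. Qed.

Lemma computable_id : computable id.
Proof.
exists (PPair PLeft PRight) => x; rewrite -{2}(npairK x).
by constructor; constructor.
Qed.

Lemma computable_comp f g :
  computable f -> computable g -> computable (fun x => f (g x)).
Proof.
by move=> [c cP] [d dP]; exists (PComp c d) => x; apply: outputs_comp (dP x) _.
Qed.

Lemma computable_succ f : computable f -> computable (fun x => (f x).+1).
Proof. by apply: computable_comp; exists PSucc => x; constructor. Qed.

Lemma computable_const k : computable (fun=> k).
Proof.
by elim: k => [|k]; [exists PZero => x; constructor | apply: computable_succ].
Qed.

Lemma computable_nleft f : computable f -> computable (fun x => nleft (f x)).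
Proof. by apply: computable_comp; exists PLeft => x; constructor. Qed.

Lemma computable_nright f : computable f -> computable (fun x => nright (f x)).
Proof. by apply: computable_comp; exists PRight => x; constructor. Qed.

Lemma computable_npair f g :
  computable f -> computable g -> computable (fun x => npair (f x) (g x)).
Proof. by move=> [c cP] [d dP]; exists (PPair c d) => x; constructor. Qed.

(** [PRec] carries the left component of its input through the recursion; this is how the parameter
    x reaches both the step and the initial value. *)
Lemma computable_iteri k g a :
    computable k -> computable (fun z => g (nleft z) (nleft (nright z)) (nright (nright z))) ->
    computable a ->
  computable (fun x => iteri (k x) (g x) (a x)).
Proof.
move=> Hk [d dP] [c cP].
have Hrec : computable (fun z => iteri (nright z) (g (nleft z)) (a (nleft z))).
  exists (PRec c d) => z; rewrite -{1}(npairK z).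
  elim: (nright z) => [|n IH] /=; first by constructor.
  apply: outputs_recS IH _.
  by have := dP (npair (nleft z) (npair n (iteri n (g (nleft z)) (a (nleft z)))));
    rewrite !(nleftK, nrightK).
apply: computable_ext (computable_comp Hrec (computable_npair computable_id Hk)).
by move=> x; rewrite /= !(nleftK, nrightK).
Qed.

Lemma computable_pred f : computable f -> computable (fun x => (f x).-1).
Proof.
move=> Hf; apply: (@computable_ext (fun x => iteri (f x) (fun i _ => i) 0)).
  by move=> x; case: (f x).
apply: computable_iteri Hf _ (computable_const 0).
exact/computable_nleft/computable_nright/computable_id.
Qed.

Lemma computable_addn f g :
  computable f -> computable g -> computable (fun x => f x + g x).
Proof.
move=> Hf Hg.
apply: (@computable_ext (fun x => iteri (g x) (fun _ r => r.+1) (f x))).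
  by move=> x; elim: (g x) => [|n /= ->]; rewrite ?addn0 ?addnS.
apply: computable_iteri Hg _ Hf.
exact/computable_succ/computable_nright/computable_nright/computable_id.
Qed.

Lemma computable_subn f g :
  computable f -> computable g -> computable (fun x => f x - g x).
Proof.
move=> Hf Hg.
apply: (@computable_ext (fun x => iteri (g x) (fun _ r => r.-1) (f x))).
  by move=> x; elim: (g x) => [|n /= ->]; rewrite ?subn0 ?subnS.
apply: computable_iteri Hg _ Hf.
exact/computable_pred/computable_nright/computable_nright/computable_id.
Qed.

Lemma computable_if (b : nat -> bool) f g :
    computable b -> computable f -> computable g ->
  computable (fun x => if b x then f x else g x).
Proof.
move=> Hb Hf Hg.
apply: (@computable_ext (fun x => iteri (b x) (fun _ _ => f x) (g x))).
  by move=> x; case: (b x).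
apply: (@computable_iteri _ (fun x _ _ => f x)) => //.
exact: (computable_comp Hf (computable_nleft computable_id)).
Qed.

Lemma computable_leq f g :
  computable f -> computable g -> computable (fun x => f x <= g x).
Proof.
move=> Hf Hg.
apply: (@computable_ext (fun x => iteri (f x - g x) (fun _ _ => 0) 1)).
  by move=> x; rewrite /leq; case: (_ - _).
apply: computable_iteri (computable_subn Hf Hg) _ _; exact: computable_const.
Qed.

Lemma computable_andb (b c : nat -> bool) :
  computable b -> computable c -> computable (fun x => b x && c x).
Proof.
move=> Hb Hc; apply: computable_ext (computable_if Hb Hc (computable_const 0)).
by move=> x; case: (b x).
Qed.

Lemma computable_orb (b c : nat -> bool) :
  computable b -> computable c -> computable (fun x => b x || c x).
Proof.
move=> Hb Hc; apply: computable_ext (computable_if Hb (computable_const 1) Hc).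
by move=> x; case: (b x).
Qed.

Lemma computable_negb (b : nat -> bool) :
  computable b -> computable (fun x => ~~ b x).
Proof.
move=> Hb.
apply: computable_ext (computable_if Hb (computable_const 0) (computable_const 1)).
by move=> x; case: (b x).
Qed.

Lemma computable_eqn f g :
  computable f -> computable g -> computable (fun x => f x == g x).
Proof.
move=> Hf Hg.
apply: (@computable_ext (fun x => (f x <= g x) && (g x <= f x))).
  by move=> x; rewrite eqn_leq.
by apply: computable_andb; apply: computable_leq.
Qed.

Lemma computable_decode_seq f :
  computable f -> computable_seq (fun x => decode_seq (f x)).
Proof. by apply: computable_ext => x; rewrite decode_seqK. Qed.

Lemma computable_seq_const s : computable_seq (fun=> s).
Proof. exact: computable_const. Qed.

Lemma computable_cons f s :
  computable f -> computable_seq s -> computable_seq (fun x => f x :: s x).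
Proof. by move=> Hf Hs; apply/computable_succ/computable_npair. Qed.

(** The state pairs the code of the remaining list with the accumulator. Codes of tails decrease, so
    the code itself bounds the number of steps; surplus steps are idle. *)
Lemma iter_foldl_code (g : nat -> nat -> nat) n k acc : k <= n ->
  iter n (fun st => if nleft st == 0 then st else
            npair (nright (nleft st).-1) (g (nright st) (nleft (nleft st).-1)))
    (npair k acc) = npair 0 (foldl g acc (decode_seq k)).
Proof.
elim: n k acc => [|n IH] k acc; first by rewrite leqn0 => /eqP ->.
rewrite iterSr !(nleftK, nrightK); case: k => [|k] le_kn; first exact: (IH 0).
by rewrite decode_seqS /= IH // (leq_trans (nright_le k)).
Qed.

Lemma computable_foldl g a s :
    computable (fun z => g (nleft z) (nleft (nright z)) (nright (nright z))) ->
    computable a -> computable_seq s ->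
  computable (fun x => foldl (g x) (a x) (s x)).
Proof.
move=> Hg Ha Hs.
pose step x (i st : nat) := if nleft st == 0 then st else
  npair (nright (nleft st).-1) (g x (nright st) (nleft (nleft st).-1)).
apply: (@computable_ext (fun x =>
    nright (iteri (encode_seq (s x)) (step x) (npair (encode_seq (s x)) (a x))))).
  move=> x.
  have -> n st : iteri n (step x) st = iter n (step x 0) st.
    by elim: n => //= n ->.
  by rewrite iter_foldl_code // nrightK encode_seqK.
apply: computable_nright; apply: computable_iteri => //; last exact: computable_npair.
have Hst : computable (fun z => nright (nright z)).
  exact/computable_nright/computable_nright/computable_id.
have Hrem : computable (fun z => nleft (nright (nright z))) by apply: computable_nleft.
apply: computable_if => //; first exact: computable_eqn (computable_const 0).
apply: computable_npair; first exact/computable_nright/computable_pred.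
have := computable_comp Hg (computable_npair (computable_nleft computable_id)
  (computable_npair (computable_nright Hst)
     (computable_nleft (computable_pred Hrem)))).
by apply: computable_ext => z; rewrite /= !(nleftK, nrightK).
Qed.

Lemma computable_rev s : computable_seq s -> computable_seq (fun x => rev (s x)).
Proof.
move=> Hs.
apply: (@computable_ext (fun x => foldl (fun t h => (npair h t).+1) 0 (s x))).
  by move=> x; rewrite /encode_seq -foldl_rev revK.
apply: computable_foldl => //; last exact: computable_const.
have Hz := computable_nright computable_id.
by apply/computable_succ/computable_npair; [apply: computable_nright|apply: computable_nleft].
Qed.

Lemma computable_foldr g a s :
    computable (fun z => g (nleft z) (nleft (nright z)) (nright (nright z))) ->
    computable a -> computable_seq s ->
  computable (fun x => foldr (g x) (a x) (s x)).
Proof.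
move=> Hg Ha Hs.
apply: (@computable_ext (fun x => foldl (fun r h => g x h r) (a x) (rev (s x)))).
  by move=> x; rewrite foldl_rev.
apply: (@computable_foldl (fun x r h => g x h r)) => //; last exact: computable_rev.
have Hz := computable_nright computable_id.
have := computable_comp Hg (computable_npair (computable_nleft computable_id)
  (computable_npair (computable_nright Hz) (computable_nleft Hz))).
by apply: computable_ext => z; rewrite /= !(nleftK, nrightK).
Qed.

Lemma computable_iota f : computable f -> computable_seq (fun x => iota 0 (f x)).
Proof.
move=> Hf; apply: (@computable_ext (fun x =>
    encode_seq (rev (decode_seq (iteri (f x) (fun i t => (npair i t).+1) 0))))).
  move=> x; rewrite -[iota _ _]revK; congr (encode_seq (rev _)).
  elim: (f x) => // n IH.
  by rewrite iteriS decode_seqS nleftK nrightK IH -[in RHS]addn1 iotaD rev_cat.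
apply: computable_rev; apply: computable_decode_seq.
apply: computable_iteri => //; last exact: computable_const.
have Hz := computable_nright computable_id.
by apply/computable_succ/computable_npair; [apply: computable_nleft|apply: computable_nright].
Qed.

(** * Closure of computability under operations on lists *)

Section SeqOperations.

Variables (P : nat -> pred nat) (g : nat -> nat -> nat) (s : nat -> seq nat).
Hypotheses (HP : computable (fun z => P (nleft z) (nright z)))
  (Hg : computable (fun z => g (nleft z) (nright z))) (Hs : computable_seq s).

Let Hz := computable_nright computable_id.
Let Harg : computable (fun z => npair (nleft z) (nleft (nright z))).
Proof. exact: computable_npair (computable_nleft computable_id) (computable_nleft Hz). Qed.

Let HP3 : computable (fun z => P (nleft z) (nleft (nright z))).
Proof.
by apply: computable_ext (computable_comp HP Harg) => z; rewrite /= nleftK nrightK.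
Qed.

Let Hg3 : computable (fun z => g (nleft z) (nleft (nright z))).
Proof.
by apply: computable_ext (computable_comp Hg Harg) => z; rewrite /= nleftK nrightK.
Qed.

Lemma computable_has : computable (fun x => has (P x) (s x)).
Proof.
apply: (@computable_ext (fun x =>
    foldr (fun h r => if P x h then 1 else r) 0 (s x))).
  by move=> x; elim: (s x) => //= h t ->; case: (P x h).
apply: (@computable_foldr (fun x h r => if P x h then 1 else r)) => //.
  by apply: computable_if => //; [apply: computable_const | apply: computable_nright].
exact: computable_const.
Qed.

Lemma computable_all : computable (fun x => all (P x) (s x)).
Proof.
apply: (@computable_ext (fun x =>
    foldr (fun h r => if P x h then r else 0) 1 (s x))).
  by move=> x; elim: (s x) => //= h t ->; case: (P x h).
apply: (@computable_foldr (fun x h r => if P x h then r else 0)) => //.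
  by apply: computable_if => //; [apply: computable_nright | apply: computable_const].
exact: computable_const.
Qed.

Lemma computable_filter : computable_seq (fun x => filter (P x) (s x)).
Proof.
apply: (@computable_ext (fun x =>
    foldr (fun h r => if P x h then (npair h r).+1 else r) 0 (s x))).
  by move=> x; elim: (s x) => //= h t ->; case: (P x h).
apply: (@computable_foldr (fun x h r => if P x h then (npair h r).+1 else r)) => //.
  apply: computable_if => //; last exact: computable_nright.
  by apply/computable_succ/computable_npair; [apply: computable_nleft|apply: computable_nright].
exact: computable_const.
Qed.

Lemma computable_map : computable_seq (fun x => map (g x) (s x)).
Proof.
apply: (@computable_ext (fun x => foldr (fun h r => (npair (g x h) r).+1) 0 (s x))).
  by move=> x; elim: (s x) => //= h t ->.
apply: (@computable_foldr (fun x h r => (npair (g x h) r).+1)) => //.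
  by apply/computable_succ/computable_npair => //; apply: computable_nright.
exact: computable_const.
Qed.

End SeqOperations.

Lemma computable_cat s t :
  computable_seq s -> computable_seq t -> computable_seq (fun x => s x ++ t x).
Proof.
move=> Hs Ht; apply: (@computable_ext (fun x =>
    foldr (fun h r => (npair h r).+1) (encode_seq (t x)) (s x))).
  by move=> x; rewrite /encode_seq foldr_cat.
apply: computable_foldr => //.
have Hz := computable_nright computable_id.
by apply/computable_succ/computable_npair; [apply: computable_nleft|apply: computable_nright].
Qed.

Lemma computable_size s : computable_seq s -> computable (fun x => size (s x)).
Proof.
move=> Hs; apply: (@computable_ext (fun x => foldr (fun _ r => r.+1) 0 (s x))).
  by move=> x; elim: (s x) => //= h t ->.
apply: computable_foldr => //; last exact: computable_const.
exact/computable_succ/computable_nright/computable_nright/computable_id.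
Qed.

(** On the code 0 of the empty list, [pred], [nright] and [nleft] all return 0, so running past the
    end gives the default value 0. *)
Lemma computable_nth s f :
  computable_seq s -> computable f -> computable (fun x => nth 0 (s x) (f x)).
Proof.
move=> Hs Hf; apply: (@computable_ext (fun x =>
    nleft (iteri (f x) (fun _ k => nright k.-1) (encode_seq (s x))).-1)).
  move=> x; move: (f x) (s x) => n l.
  have -> st : iteri n (fun _ k => nright k.-1) st = iter n (fun k => nright k.-1) st.
    by elim: n => //= n ->.
  elim: n l => [|n IH] [|h t]; rewrite ?iterSr //= ?nleftK ?nrightK ?IH //.
  by rewrite (IH [::]) nth_nil.
apply: computable_nleft; apply: computable_pred; apply: computable_iteri => //.
exact/computable_nright/computable_pred/computable_nright/computable_nright/computable_id.
Qed.

Lemma computable_mem s f :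
  computable_seq s -> computable f -> computable (fun x => f x \in s x).
Proof.
move=> Hs Hf; apply: (@computable_ext (fun x => has (pred1 (f x)) (s x))).
  by move=> x; rewrite has_pred1.
apply: (@computable_has (fun x => pred1 (f x))) => //.
apply: computable_eqn; first exact/computable_nright/computable_id.
exact: computable_comp Hf (computable_nleft computable_id).
Qed.

(** * Certificates of computations *)

Lemma npair_inj a b c d : npair a b = npair c d -> a = c /\ b = d.
Proof.
move=> e; split; first by rewrite -(nleftK a b) e nleftK.
by rewrite -(nrightK a b) e nrightK.
Qed.

Fixpoint encode_program (c : program) : nat :=
  match c with
  | PZero => npair 0 0
  | PSucc => npair 1 0
  | PLeft => npair 2 0
  | PRight => npair 3 0
  | PPair f g => npair 4 (npair (encode_program f) (encode_program g))
  | PComp f g => npair 5 (npair (encode_program f) (encode_program g))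
  | PRec f g => npair 6 (npair (encode_program f) (encode_program g))
  | PMu f => npair 7 (npair (encode_program f) 0)
  end.

Definition run (e x y : nat) : nat := npair e (npair x y).

(* The run h follows by one rule of [outputs] from runs in s; a number e that is
   not the code of a programme is harmless, since it occurs in no premise of a
   genuine run. *)
Definition justified (h : nat) (s : seq nat) : bool :=
  let e := nleft h in let x := nleft (nright h) in let y := nright (nright h) in
  let tag := nleft e in
  let f := nleft (nright e) in let g := nright (nright e) in
  [|| (tag == 0) && (y == 0),
      (tag == 1) && (y == x.+1),
      (tag == 2) && (y == nleft x),
      (tag == 3) && (y == nright x),
      [&& tag == 4, run f x (nleft y) \in s & run g x (nright y) \in s],
      (tag == 5) &&
        has (fun r => (r == run g x (nright (nright r))) &&
                      (run f (nright (nright r)) y \in s)) s,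
      [&& tag == 6, nright x == 0 & run f (nleft x) y \in s],
      [&& tag == 6, nright x != 0 &
        has (fun r =>
          (r == run e (npair (nleft x) (nright x).-1) (nright (nright r))) &&
          (run g (npair (nleft x) (npair (nright x).-1 (nright (nright r)))) y
            \in s)) s]
    | [&& tag == 7, run f (npair x y) 0 \in s &
        all (fun j => has (fun r => (nright (nright r) != 0) &&
               (r == run f (npair x j) (nright (nright r)))) s) (iota 0 y)]].

Fixpoint certificate (s : seq nat) : bool :=
  if s is h :: t then justified h t && certificate t else true.

Definition sound (s : seq nat) : Prop :=
  forall c x y, run (encode_program c) x y \in s -> outputs c x y.

(** Supplies the function [v] that the rule [outputs_mu] requires. *)
Lemma finite_choice (P : nat -> nat -> Prop) k :
  (forall j, j < k -> exists v, P j v) ->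
  exists v : nat -> nat, forall j, j < k -> P j (v j).
Proof.
elim: k => [|k IH] HP; first by exists id.
have [|v vP] := IH; first by move=> j jk; apply: HP; apply: ltnW.
have [w wP] := HP k (ltnSn k).
exists (fun j => if j == k then w else v j) => j; rewrite ltnS leq_eqVlt.
by case: eqP => [-> //|_ /=]; apply: vP.
Qed.

Lemma justified_sound c x y s :
  sound s -> justified (run (encode_program c) x y) s -> outputs c x y.
Proof.
move=> Hs; rewrite /justified [run (encode_program c) x y]/run !(nleftK, nrightK).
(* The tags are distinct numerals, so simplification leaves only the clauses that belong to the
   constructor at hand. *)
case: c => [||||f g|f g|f g|f]; rewrite [encode_program _]/= !(nleftK, nrightK) /=;
  rewrite ?(andbF, orbF).
- by move=> /eqP->; constructor.
- by move=> /eqP->; constructor.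
- by move=> /eqP->; constructor.
- by move=> /eqP->; constructor.
- case/andP=> /Hs Hf /Hs Hg; rewrite -(npairK y); exact: outputs_pair.
- case/hasP=> r rs /andP[/eqP er /Hs Hf]; rewrite er in rs.
  exact: outputs_comp (Hs _ _ _ rs) Hf.
- move: (npairK x); move: (nleft x) (nright x) => a [|k] <- /=.
    by rewrite orbF => /Hs; apply: outputs_rec0.
  case/hasP=> r rs /andP[/eqP er /Hs Hg]; rewrite er in rs.
  exact: outputs_recS (Hs (PRec f g) _ _ rs) Hg.
case/andP=> /Hs Hf /allP Hall.
have [|v vP] := @finite_choice (fun j w => outputs f (npair x j) w.+1) y.
  move=> j jy; have := Hall j; rewrite mem_iota => /(_ jy) /hasP[r rs].
  case/andP; case: (nright _) => // w _ /eqP er; rewrite er in rs.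
  by exists w; apply: Hs.
exact: outputs_mu vP Hf.
Qed.

Lemma certificate_sound s : certificate s -> sound s.
Proof.
elim: s => [_ c x y|h s IH /= /andP[Hh /IH Hs] c x y]; first by [].
rewrite inE => /orP[/eqP eh|]; last exact: Hs.
by apply: justified_sound Hs _; rewrite eh.
Qed.

(** Every membership in [justified] occurs positively. Hence certificates can be concatenated, which
    is how the premises of a rule are brought together. *)
Lemma justifiedW h (s t : seq nat) :
  {subset s <= t} -> justified h s -> justified h t.
Proof.
move=> sub; rewrite /justified.
have Hhas (P Q : pred nat) : (forall r, P r -> Q r) -> has P s -> has Q t.
  by move=> PQ /hasP[r /sub rt /PQ Qr]; apply/hasP; exists r.
set e := nleft h; set x := nleft (nright h); set y := nright (nright h).
case/or4P; [by move=> -> | by move=> ->; rewrite ?orbT | by move=> ->; rewrite ?orbT |].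
case/or4P; [by move=> ->; rewrite ?orbT | | |].
- by case/and3P=> -> /sub -> /sub ->; rewrite ?orbT.
- case/andP=> -> H; suff -> : has (fun r => (r == run (nright (nright e)) x (nright (nright r))) &&
     (run (nleft (nright e)) (nright (nright r)) y \in t)) t by rewrite ?orbT.
  by apply: Hhas H => r /andP[-> /sub].
case/or3P.
- by case/and3P=> -> -> /sub ->; rewrite ?orbT.
- case/and3P=> Ht Hx H; apply/or4P/Or44/or4P/Or44/or3P/Or32; rewrite Ht Hx /=.
  by apply: Hhas H => r /andP[-> /sub].
case/and3P=> Ht /sub Hf /allP H; apply/or4P/Or44/or4P/Or44/or3P/Or33.
rewrite Ht Hf /=; apply/allP=> j /H; exact: Hhas.
Qed.

Lemma certificate_cat s t : certificate s -> certificate t -> certificate (s ++ t).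
Proof.
elim: s => //= h s IH /andP[Hh Hs] Ht; rewrite IH // andbT.
by apply: justifiedW Hh => r; rewrite mem_cat => ->.
Qed.

(** By induction on the run: the certificates of the premises are concatenated and the conclusion is
    put in front; for [PMu] there are k + 1 of them. *)
Lemma certificate_complete c x y : outputs c x y ->
  exists2 s, certificate s & run (encode_program c) x y \in s.
Proof.
have conclude tag r x' y' s :
    certificate s -> justified (npair (npair tag r) (npair x' y')) s ->
    exists2 s, certificate s & run (npair tag r) x' y' \in s.
  by move=> Hs Hj; exists (run (npair tag r) x' y' :: s); rewrite ?mem_head //= Hj.
elim=> {c x y}.
- by move=> x; apply: (conclude _ _ _ _ [::]) => //; rewrite /justified !(nleftK, nrightK).
- move=> x; apply: (conclude _ _ _ _ [::]) => //.
  by rewrite /justified !(nleftK, nrightK) /= ?eqxx ?orbT.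
- move=> x; apply: (conclude _ _ _ _ [::]) => //.
  by rewrite /justified !(nleftK, nrightK) /= ?eqxx ?orbT.
- move=> x; apply: (conclude _ _ _ _ [::]) => //.
  by rewrite /justified !(nleftK, nrightK) /= ?eqxx ?orbT.
- move=> f g x y z _ [s Hs fs] _ [t Ht gt]; apply: (conclude _ _ _ _ (s ++ t)).
    exact: certificate_cat.
  by rewrite /justified !(nleftK, nrightK) !mem_cat fs gt /= ?orbT.
- move=> f g x y z _ [s Hs fs] _ [t Ht gt]; apply: (conclude _ _ _ _ (s ++ t)).
    exact: certificate_cat.
  rewrite /justified !(nleftK, nrightK); apply/or4P/Or44/or4P/Or43.
  rewrite eqxx /=; apply/hasP; exists (run (encode_program g) x y); first by rewrite mem_cat fs.
  by rewrite !(nleftK, nrightK) eqxx mem_cat gt orbT.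
- move=> f g a y _ [s Hs fs]; apply: (conclude _ _ _ _ s) => //.
  by rewrite /justified !(nleftK, nrightK) fs /= ?orbT.
- move=> f g a k y z _ [s Hs fs] _ [t Ht gt]; apply: (conclude _ _ _ _ (s ++ t)).
    exact: certificate_cat.
  rewrite /justified !(nleftK, nrightK); apply/or4P/Or44/or4P/Or44/or3P/Or32.
  rewrite eqxx /=; apply/hasP; exists (run (encode_program (PRec f g)) (npair a k) y); first by rewrite mem_cat fs.
  by rewrite !(nleftK, nrightK) eqxx mem_cat gt orbT.
move=> f a k v _ Hv _ [s Hs fs].
have [t Ht tv] : exists2 t, certificate t &
    forall j, j < k -> run (encode_program f) (npair a j) (v j).+1 \in t.
  elim: k Hv {fs} => [|k IH] Hv; first by exists [::].
  have [|t Ht tv] := IH; first by move=> j jk; apply/Hv/ltnW.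
  have [t' Ht' tv'] := Hv k (ltnSn k).
  exists (t' ++ t) => [|j]; first exact: certificate_cat.
  rewrite ltnS leq_eqVlt mem_cat => /orP[/eqP->|/tv ->]; first by rewrite tv'.
  by rewrite orbT.
apply: (conclude _ _ _ _ (s ++ t)); first exact: certificate_cat.
rewrite /justified !(nleftK, nrightK); apply/or4P/Or44/or4P/Or44/or3P/Or33.
rewrite mem_cat fs eqxx /=; apply/allP => j; rewrite mem_iota => /tv jt.
apply/hasP; exists (run (encode_program f) (npair a j) (v j).+1).
  by rewrite mem_cat jt orbT.
by rewrite !(nleftK, nrightK) eqxx.
Qed.

(** With an arbitrary x the equations between codes stay explicit and can be solved by [npair_inj];
    [npair a k] is not a constructor form. *)
Lemma outputs_PRec f g x z : outputs (PRec f g) x z ->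
  (exists2 a, x = npair a 0 & outputs f a z) \/
  (exists a k y, [/\ x = npair a k.+1, outputs (PRec f g) (npair a k) y
                   & outputs g (npair a (npair k y)) z]).
Proof.
move=> H; inversion H as [| | | | | |? ? a ? Hf|? ? a k y ? Hk Hg|]; subst.
  by left; exists a.
by right; exists a, k, y.
Qed.

(** Identifies a value recorded in a certificate with the output that decodes to the given sequence.
    For [PMu], the smaller of two results would be both a zero and a positive value of f. *)
Lemma outputs_functional c x y z : outputs c x y -> outputs c x z -> y = z.
Proof.
move=> H; elim: H z => {c x y}.
- by move=> x z H; inversion H.
- by move=> x z H; inversion H.
- by move=> x z H; inversion H.
- by move=> x z H; inversion H.
- by move=> f g x y y' _ IHf _ IHg z H; inversion H; subst; rewrite (IHf y0) // (IHg z0).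
- move=> f g x y y' _ IHg _ IHf z H; inversion H; subst.
  by rewrite -(IHg y0) // in H5; apply: IHf.
- move=> f g a y _ IH z /outputs_PRec[[b /npair_inj[<- _]]|]; first exact: IH.
  by case=> [b [k [w [/npair_inj[]]]]].
- move=> f g a k y y' _ IHk _ IHg z /outputs_PRec[[b /npair_inj[]]|] //.
  by case=> [b [l [w [/npair_inj[<- [<-]] /IHk <- /IHg]]]].
move=> f a k v Hv IHv Hk IHk z H; inversion H as [| | | | | | | |? ? ? v' Hv' Hz]; subst.
case: (ltngtP k z) => // [kz|zk]; first by have := IHk _ (Hv' _ kz).
by have := IHv _ zk _ Hz.
Qed.

(** Syntax-directed: the head symbol selects the closure lemma, and the patterns [@?f x] recover the
    arguments as functions of the input. *)
Ltac computability_step :=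
  cbv beta;
  lazymatch goal with
  | |- computable_seq (fun _ => ?s) => refine (@computable_seq_const s)
  | |- computable_seq (fun x => decode_seq (@?f x)) => refine (@computable_decode_seq f _)
  | |- computable_seq (fun x => iota 0 (@?f x)) => refine (@computable_iota f _)
  | |- computable_seq (fun x => @?s x ++ @?t x) => refine (@computable_cat s t _ _)
  | |- computable_seq (fun x => filter (@?P x) (@?s x)) =>
      refine (@computable_filter P s _ _)
  | |- computable_seq (fun x => map (@?f x) (@?s x)) => refine (@computable_map f s _ _)
  | |- computable_seq (fun x => @?h x :: @?s x) => refine (@computable_cons h s _ _)
  | |- computable (fun x => x) => exact computable_id
  | |- computable (fun _ => ?k) => exact (computable_const k)
  | |- computable (fun x => encode_seq (@?s x)) => change (computable_seq s)
  | |- computable (fun x => foldr (@?g x) (@?a x) (@?s x)) =>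
      refine (@computable_foldr g a s _ _ _)
  | |- computable (fun x => nleft (@?f x)) => refine (@computable_nleft f _)
  | |- computable (fun x => nright (@?f x)) => refine (@computable_nright f _)
  | |- computable (fun x => npair (@?f x) (@?g x)) => refine (@computable_npair f g _ _)
  | |- computable (fun x => S (@?f x)) => refine (@computable_succ f _)
  | |- computable (fun x => predn (@?f x)) => refine (@computable_pred f _)
  | |- computable (fun x => addn (@?f x) (@?g x)) => refine (@computable_addn f g _ _)
  | |- computable (fun x => if _ then _ else _) => refine (@computable_if _ _ _ _ _ _)
  | |- computable (fun x => size (@?s x)) => refine (@computable_size s _)
  | |- computable (fun x => nth 0 (@?s x) (@?f x)) => refine (@computable_nth s f _ _)
  | |- computable (fun x => nat_of_bool (@?b x && @?c x)) =>
      refine (@computable_andb b c _ _)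
  | |- computable (fun x => nat_of_bool (@?b x || @?c x)) =>
      refine (@computable_orb b c _ _)
  | |- computable (fun x => nat_of_bool (~~ @?b x)) => refine (@computable_negb b _)
  | |- computable (fun x => nat_of_bool (@?f x <= @?g x)) =>
      refine (@computable_leq f g _ _)
  | |- computable (fun x => nat_of_bool (@?f x == @?g x)) =>
      refine (@computable_eqn f g _ _)
  | |- computable (fun x => nat_of_bool (has (@?P x) (@?s x))) =>
      refine (@computable_has P s _ _)
  | |- computable (fun x => nat_of_bool (all (@?P x) (@?s x))) =>
      refine (@computable_all P s _ _)
  | |- computable (fun x => nat_of_bool (@?f x \in @?s x)) =>
      refine (@computable_mem s f _ _)
  end.

Ltac computability := repeat first [computability_step | solve [auto]].

Lemma computable_justified :
  computable (fun x => justified (nleft x) (decode_seq (nright x))).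
Proof. rewrite /justified /run; cbv zeta; computability. Qed.

Lemma computable_certificate s :
  computable_seq s -> computable (fun x => certificate (s x)).
Proof.
move=> Hs; pose step h st := npair (npair h (nleft st)).+1
  (justified h (decode_seq (nleft st)) && (nright st != 0)).
apply: (@computable_ext (fun x => nright (foldr step (npair 0 1) (s x)))).
  move=> x; suff -> : foldr step (npair 0 1) (s x) =
      npair (encode_seq (s x)) (certificate (s x)) by rewrite nrightK.
  elim: (s x) => //= h t ->; rewrite /step !(nleftK, nrightK) encode_seqK.
  by case: (certificate t).
apply: computable_nright; apply: (@computable_foldr (fun _ => step)) => //;
  rewrite /step; computability.
have Hz : computable (fun z => npair (nleft (nright z)) (nleft (nright (nright z)))).
  by computability.
apply: computable_ext (computable_comp computable_justified Hz).
by move=> z; rewrite !(nleftK, nrightK).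
Qed.

(** * Operations on codes of polynomials *)

Section PolynomialCodes.

Variables (F : finFieldType) (m : nat).
Implicit Types p q : free_alg F m.

(** A general predicate covers both homogeneous components ([pred1 k]) and truncations
    ([ltn^~ d]). *)
Definition degree_part (P : pred nat) p : free_alg F m :=
  [malg w in msupp p => if P (fdeg w) then p@_w else 0]%R.

Lemma mcoeff_degree_part P p w :
  (degree_part P p)@_w = if P (fdeg w) then p@_w else 0%R.
Proof.
by rewrite mcoeffE; case: ifP => // /negbT /mcoeff_outdom ->; rewrite if_same.
Qed.

Lemma degree_partD P p q :
  degree_part P (p + q)%R = (degree_part P p + degree_part P q)%R.
Proof.
apply/malgP => w; rewrite mcoeffD !mcoeff_degree_part mcoeffD.
by case: ifP => // _; rewrite addr0.
Qed.

Lemma degree_part0 P : degree_part P 0%R = 0%R.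
Proof. by apply/malgP => w; rewrite mcoeff_degree_part mcoeff0 if_same. Qed.

Lemma degree_partU P c w :
  (degree_part P << c *g w >> = if P (fdeg w) then << c *g w >> else 0)%R.
Proof.
apply/malgP => v; rewrite mcoeff_degree_part mcoeffU.
case: (w =P v) => [<-|neq]; first by case: ifP; rewrite ?mcoeffUU ?mcoeff0.
by rewrite mulr0n if_same; case: ifP; rewrite ?mcoeff0 // mcoeffU; move/eqP/negbTE: neq => ->.
Qed.

Lemma degree_part_sum P (I : Type) (r : seq I) (G : I -> free_alg F m) :
  degree_part P (\sum_(i <- r) G i)%R = (\sum_(i <- r) degree_part P (G i))%R.
Proof. exact: (big_morph _ (degree_partD P) (degree_part0 P)). Qed.

Definition coef_index (a : F) : nat := index a (enum F).

Lemma coef_indexK : cancel coef_index (decode_coef F).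
Proof. by move=> a; rewrite /decode_coef nth_index ?mem_enum. Qed.

(** All codes from #|F| on decode to 0, so every code is equivalent to one of #|F| + 1 indices. The
    arithmetic of the abstract field F thus becomes look-up in constant finite tables, which is
    computable. *)
Definition clamp (k : nat) := if k <= #|F| then k else #|F|.

Lemma clamp_lt k : clamp k < #|F|.+1.
Proof. by rewrite /clamp ltnS; case: ifP. Qed.

Lemma decode_coef_clamp k : decode_coef F (clamp k) = decode_coef F k.
Proof.
rewrite /clamp; case: leqP => // lt; rewrite /decode_coef !nth_default -?cardE //.
exact: ltnW.
Qed.

Definition add_code (a b : nat) : nat :=
  nth 0 (decode_seq (nth 0
    [seq encode_seq [seq coef_index (decode_coef F i + decode_coef F j)%R
           | j <- iota 0 #|F|.+1] | i <- iota 0 #|F|.+1] (clamp a))) (clamp b).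

Lemma add_codeE a b :
  decode_coef F (add_code a b) = (decode_coef F a + decode_coef F b)%R.
Proof.
rewrite /add_code (nth_map 0) ?size_iota ?clamp_lt // nth_iota ?clamp_lt //.
rewrite encode_seqK (nth_map 0) ?size_iota ?clamp_lt // nth_iota ?clamp_lt //.
by rewrite coef_indexK !add0n !decode_coef_clamp.
Qed.

Definition opp_code (a : nat) : nat :=
  nth 0 [seq coef_index (- decode_coef F i)%R | i <- iota 0 #|F|.+1] (clamp a).

Lemma opp_codeE a : decode_coef F (opp_code a) = (- decode_coef F a)%R.
Proof.
rewrite /opp_code (nth_map 0) ?size_iota ?clamp_lt // nth_iota ?clamp_lt //.
by rewrite coef_indexK add0n decode_coef_clamp.
Qed.

Definition is_zero_code (a : nat) : bool := (a == coef_index 0%R) || (#|F| <= a).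

Lemma is_zero_codeP a : is_zero_code a = (decode_coef F a == 0%R).
Proof.
rewrite /is_zero_code /decode_coef; case: leqP => [le|lt].
  by rewrite orbT nth_default ?eqxx // -cardE.
rewrite orbF; apply/eqP/eqP => [->|]; first by rewrite nth_index ?mem_enum.
by move=> <-; rewrite /coef_index index_uniq ?enum_uniq // -cardE.
Qed.

(** A normal form: distinct codes can denote the same word, because letters from m on are
    skipped. *)
Definition letters (w : nat) : seq nat := [seq i <- decode_seq w | i < m].

Lemma lettersE w : letters w = map val (decode_word m w : seq 'I_m).
Proof.
rewrite /letters /decode_word /=.
by elim: (decode_seq w) => //= i s ->; case: insubP => [j -> <-|/negbTE->].
Qed.

Lemma fdeg_decode_word w : fdeg (decode_word m w) = size (letters w).
Proof. by rewrite fdegE lettersE size_map. Qed.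

Lemma eq_decode_word v w : (decode_word m v == decode_word m w) =
  (encode_seq (letters v) == encode_seq (letters w)).
Proof.
rewrite (can_eq encode_seqK) !lettersE fmP.
by rewrite (inj_eq (inj_map val_inj)).
Qed.

Definition component_code (k y : nat) : nat :=
  encode_seq [seq t <- decode_seq y | size (letters (nright t)) == k].

Lemma component_codeE k y :
  decode_poly F m (component_code k y) = degree_part (pred1 k) (decode_poly F m y).
Proof.
rewrite /decode_poly encode_seqK degree_part_sum big_filter big_mkcond.
by apply: eq_bigr => t _; rewrite degree_partU /= fdeg_decode_word.
Qed.

Definition sub_code (y z : nat) : nat :=
  encode_seq (decode_seq y ++
    [seq npair (opp_code (nleft t)) (nright t) | t <- decode_seq z]).

Lemma sub_codeE y z :
  decode_poly F m (sub_code y z) = (decode_poly F m y - decode_poly F m z)%R.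
Proof.
rewrite /decode_poly encode_seqK big_cat big_map /=; congr +%R.
rewrite -sumrN; apply: eq_bigr => t _.
by rewrite nleftK nrightK opp_codeE monalgUN.
Qed.

Definition coef_code (y w : nat) : nat :=
  foldr (fun t c => if encode_seq (letters (nright t)) == encode_seq (letters w)
                    then add_code (nleft t) c else c)
    (coef_index 0%R) (decode_seq y).

Lemma coef_codeE y w :
  decode_coef F (coef_code y w) = (decode_poly F m y)@_(decode_word m w).
Proof.
rewrite /coef_code /decode_poly; elim: (decode_seq y) => [|t s IH] /=.
  by rewrite big_nil mcoeff0 coef_indexK.
rewrite big_cons mcoeffD -IH mcoeffU eq_decode_word.
by case: eqP => _; rewrite ?add_codeE ?mulr0n ?add0r.
Qed.

(** It is enough to test words listed in y, as all others have coefficient 0. The whole coefficient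
    is computed since a word may be listed several times and its terms may cancel. *)
Definition vanishes_below (d y : nat) : bool :=
  all (fun t => (d <= size (letters (nright t))) ||
                is_zero_code (coef_code y (nright t))) (decode_seq y).

Lemma vanishes_belowP d y :
  reflect (forall w : {fmonom 'I_m}, fdeg w < d -> (decode_poly F m y)@_w = 0%R)
    (vanishes_below d y).
Proof.
apply: (iffP allP) => [H w lt_wd|H t _]; last first.
  rewrite is_zero_codeP coef_codeE -fdeg_decode_word.
  by case: leqP => //= /H ->.
case: (boolP (has (fun t => decode_word m (nright t) == w) (decode_seq y))).
  case/hasP=> t /H; rewrite is_zero_codeP coef_codeE -fdeg_decode_word => Ht /eqP tw.
  by move: Ht; rewrite tw leqNgt lt_wd /= => /eqP.
move=> /hasPn Hn; rewrite /decode_poly raddf_sum big1_seq // => t /andP[_ /Hn].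
by rewrite /= mcoeffU => /negbTE ->.
Qed.

End PolynomialCodes.

(** * Infinite dimension: the Golod-Shafarevich count *)

Section MonomialInduction.

Variables (F : finFieldType) (m : nat).

Lemma free_alg_ind (P : free_alg F m -> Prop) :
    P 0%R -> (forall p q, P p -> P q -> P (p + q)%R) ->
    (forall c w, P (<< c *g w >>)%R) ->
  forall p, P p.
Proof. by move=> P0 PD PU p; rewrite [p]monalgE; apply: big_ind. Qed.

Lemma monalgM (c d : F) (v w : {fmonom 'I_m}) :
  (<< c *g v >> * << d *g w >> = << c * d *g mmul v w >> :> free_alg F m)%R.
Proof. by rewrite malgM_def fgmulUU. Qed.

End MonomialInduction.

(** A substitute for rank-nullity: subtracting a fixed element of a fibre embeds that fibre into
    K. *)
Lemma card_fibers (V W : finType) (A K : {set V}) (B : {set W}) (f : V -> W)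
    (sub : V -> V -> V) :
    (forall x, x \in A -> f x \in B) -> (forall y, injective (sub^~ y)) ->
    (forall x y, x \in A -> y \in A -> f x = f y -> sub x y \in K) ->
  #|A| <= #|K| * #|B|.
Proof.
move=> fAB sub_inj HK; rewrite -sum1_card (partition_big f (mem B)) //=.
rewrite mulnC -sum_nat_const; apply: leq_sum => b _.
rewrite sum1_card; case: (pickP [pred x in A | f x == b]) => [y|none]; last first.
  by rewrite eq_card0.
case/andP=> yA /eqP fy; rewrite -(card_imset _ (sub_inj y)) subset_leq_card //.
apply/subsetP => _ /imsetP[x /andP[xA /eqP fx] ->]; apply: HK => //.
by rewrite fx fy.
Qed.

(** Here c k stands for |F| to the dimension in degree k, so squaring means doubling. By induction c
    (k - j) is at most the 2^j-th root of c k; the product is then at most c k ^ (m - 2), and two of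
    the m factors are left. *)
Lemma doubling (c s : nat -> nat) m :
    1 < m -> (forall k, 0 < c k) ->
    (forall k, c k ^ m <= c k.+1 * \prod_(j < k.+1) c (k - j) ^ s j) ->
    (forall k, \sum_(j < k.+1) s j * 2 ^ (k - j) <= (m - 2) * 2 ^ k) ->
  forall k, c k ^ 2 <= c k.+1.
Proof.
move=> m1 c0 step budget; elim/ltn_ind=> k IH.
have chain i : i <= k -> c (k - i) ^ (2 ^ i) <= c k.
  elim: i => [_|i IHi lt_ik]; first by rewrite subn0 expn1.
  apply: leq_trans (IHi (ltnW lt_ik)); rewrite expnS expnM leq_exp2r ?expn_gt0 //.
  rewrite -(subnSK lt_ik); apply: IH.
  by rewrite ltn_subrL (leq_trans _ lt_ik).
have prod_le : \prod_(j < k.+1) c (k - j) ^ s j <= c k ^ (m - 2).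
  (* Raising to the power 2^k clears the denominators 2^j, so that roots are avoided. *)
  rewrite -(@leq_exp2r _ _ (2 ^ k)) ?expn_gt0 // -expnM.
  apply: leq_trans (leq_pexp2l (c0 k) (budget k)).
  rewrite expn_sum (big_morph (expn^~ (2 ^ k)) (fun x y => expnMn x y _) (exp1n _)).
  apply: leq_prod => j _; have le_jk : j <= k by rewrite -ltnS.
  have -> : (c (k - j) ^ s j) ^ (2 ^ k) = (c (k - j) ^ (2 ^ j)) ^ (s j * 2 ^ (k - j)).
    by rewrite -!expnM mulnCA -expnD subnKC.
  by elim: (s j * _) => // e IHe; rewrite !expnS leq_mul ?chain.
have := step k; rewrite -{1}(subnKC m1) expnD => /leq_trans H.
have {H} := H _ (leq_mul (leqnn _) prod_le).
by rewrite leq_pmul2r // expn_gt0 c0.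
Qed.

(** * The Golod-Shafarevich inequality for dual spaces *)

Section GolodShafarevich.

Variables (F : finFieldType) (m : nat) (rels : nat -> seq (free_alg F m)).
Local Notation word := (seq 'I_m).
Local Notation form k := {ffun k.-tuple 'I_m -> F}.
Implicit Types (g h : word -> F) (p q : free_alg F m).

Hypothesis rels_homogeneous : forall j r (w : {fmonom 'I_m}),
  r \in rels j -> (r@_w)%R != 0%R -> size w = j.

(** Arbitrary functions on words form the full dual of the free algebra; this is the evaluation
    pairing. *)
Definition pairing (g : word -> F) : free_alg F m -> F :=
  mmap idfun (fun w : {fmonom 'I_m} => g w).

Lemma eq_pairing g h p :
  (forall w : {fmonom 'I_m}, p@_w != 0%R -> g w = h w) -> pairing g p = pairing h p.
Proof.
move=> gh; apply: eq_bigr => w _; have [->|/gh -> //] := eqVneq (p@_w) 0%R.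
by rewrite !mul0r.
Qed.

Lemma pairing_eq0 g p :
  (forall w : {fmonom 'I_m}, p@_w != 0%R -> g w = 0%R) -> pairing g p = 0%R.
Proof.
move=> /(@eq_pairing _ (fun=> 0%R)) ->; rewrite /pairing mmapE big1 // => w _.
by rewrite mulr0.
Qed.

Lemma pairingU g c (w : {fmonom 'I_m}) : (pairing g << c *g w >> = c * g w)%R.
Proof. exact: mmapU. Qed.

Lemma pairingD g p q : (pairing g (p + q) = pairing g p + pairing g q)%R.
Proof. exact: mmapD. Qed.

Lemma pairing0 g : (pairing g 0 = 0)%R.
Proof. exact: mmap0. Qed.

Lemma pairing_subfun g h p :
  (pairing (fun w => g w - h w) p = pairing g p - pairing h p)%R.
Proof. by rewrite /pairing !mmapE -sumrB; apply: eq_bigr => w _; rewrite mulrBr. Qed.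

Lemma pairing_exchange (g : word -> word -> F) p q :
  pairing (fun v => pairing (g v) q) p = pairing (fun w => pairing (g^~ w) p) q.
Proof.
rewrite /pairing !mmapE /=.
under eq_bigr do rewrite mmapE mulr_sumr.
rewrite exchange_big /=; apply: eq_bigr => w _; rewrite mmapE mulr_sumr.
by apply: eq_bigr => v _; rewrite mulrCA.
Qed.

Lemma pairingM g p q :
  (pairing g (p * q) = pairing (fun v => pairing (fun w => g (v ++ w)) q) p)%R.
Proof.
elim/free_alg_ind: p => [|p p' IH IH'|c v].
- by rewrite mul0r !pairing0.
- by rewrite mulrDl [LHS]pairingD [RHS]pairingD; congr +%R.
rewrite pairingU; elim/free_alg_ind: q => [|q q' IH IH'|d w].
- by rewrite mulr0 !pairing0 mulr0.
- by rewrite mulrDr [LHS]pairingD pairingD mulrDr; congr +%R.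
by rewrite monalgM !pairingU fmM mulrA.
Qed.

Lemma pairing_delta (w : word) (a : F) p :
  (pairing (fun v => (v == w)%:R * a) p = p@_(FMonom w) * a)%R.
Proof.
elim/free_alg_ind: p => [|p q IHp IHq|c v].
- by rewrite pairing0 mcoeff0 mul0r.
- by rewrite pairingD IHp IHq mcoeffD mulrDl.
by rewrite pairingU mcoeffU fmP /=; case: eqP; rewrite ?mul1r // !mul0r mulr0.
Qed.

(** The extension by 0 to words of other lengths makes terms of the wrong degree vanish by
    themselves. *)
Definition eval_form k (f : form k) (s : word) : F := oapp f 0%R (insub s).

Definition form_of k (g : word -> F) : form k := [ffun t : k.-tuple 'I_m => g t].

Lemma eval_form_of k g s : eval_form (form_of k g) s = if size s == k then g s else 0%R.
Proof. by rewrite /eval_form; case: insubP => [t -> <-|/negbTE->] //=; rewrite ffunE. Qed.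

Lemma eval_form_size k (f : form k) s : size s != k -> eval_form f s = 0%R.
Proof. by move=> sk; rewrite /eval_form insubN. Qed.

Lemma eval_formP k (f g : form k) :
  (forall s, size s = k -> eval_form f s = eval_form g s) -> f = g.
Proof.
by move=> fg; apply/ffunP => t; have := fg t (size_tuple t); rewrite /eval_form valK.
Qed.

Lemma eval_formB k (f g : form k) s :
  (eval_form (f - g) s = eval_form f s - eval_form g s)%R.
Proof.
by rewrite /eval_form; case: insubP => [t _ _|_] /=; rewrite ?ffunE ?ffunE ?subr0.
Qed.

Lemma eval_form0 k s : (eval_form (0 : form k) s = 0)%R.
Proof. by rewrite /eval_form; case: insubP => [t _ _|_] /=; rewrite ?ffunE. Qed.

(* The dual of the component of degree k of the quotient algebra. *)
Definition annihilator k : {set form k} :=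
  [set f | `[< forall j r u v, r \in rels j ->
                 pairing (fun w => eval_form f (u ++ w ++ v)) r = 0%R >]].

Lemma annihilatorP k (f : form k) :
  reflect (forall j r u v, r \in rels j ->
             pairing (fun w => eval_form f (u ++ w ++ v)) r = 0%R)
    (f \in annihilator k).
Proof. by rewrite inE; apply: asboolP. Qed.

Lemma pairing_mismatch k (f : form k) j r u v :
  r \in rels j -> size u + j + size v != k ->
  pairing (fun w => eval_form f (u ++ w ++ v)) r = 0%R.
Proof.
move=> rj neq; apply: pairing_eq0 => w wr.
rewrite eval_form_size //; apply: contraNneq neq => <-.
by rewrite !size_cat (rels_homogeneous rj wr) addnA.
Qed.

Lemma annihilatorB k (f g : form k) :
  f \in annihilator k -> g \in annihilator k -> (f - g)%R \in annihilator k.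
Proof.
move=> /annihilatorP Hf /annihilatorP Hg; apply/annihilatorP => j r u v rj.
rewrite (@eq_pairing _ (fun w => eval_form f (u ++ w ++ v) - eval_form g (u ++ w ++ v))%R).
  by rewrite pairing_subfun (Hf j) // (Hg j) // subrr.
by move=> w _; rewrite eval_formB.
Qed.

Lemma annihilator0 k : 0%R \in annihilator k.
Proof.
by apply/annihilatorP => j r u v _; apply: pairing_eq0 => w _; rewrite eval_form0.
Qed.

(** Multipliers on the left and right of a relator are absorbed into the contexts u and v, over
    which the claim is quantified. *)
Lemma pairing_ideal k (f : form k) (R : free_alg F m -> Prop) :
    f \in annihilator k -> (forall p, R p -> p = 0%R \/ exists j, p \in rels j) ->
  forall p, ideal_generated R p ->
    forall u v, pairing (fun w => eval_form f (u ++ w ++ v)) p = 0%R.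
Proof.
move=> /annihilatorP Hf HR p; elim=> {p} [p /HR [->|[j pj]] u v||p q _ IHp _ IHq u v|
    p q _ IH u v|p q _ IH u v].
- exact: pairing0.
- exact: Hf pj.
- by move=> u v; exact: pairing0.
- by rewrite pairingD IHp IHq addr0.
- rewrite pairingM; apply: pairing_eq0 => a _; rewrite -[RHS](IH (u ++ a) v).
  by apply: eq_pairing => b _; rewrite !catA.
rewrite pairingM pairing_exchange; apply: pairing_eq0 => b _.
by rewrite -[RHS](IH u (b ++ v)); apply: eq_pairing => a _; rewrite !catA.
Qed.

Hypothesis rels0 : rels 0 = [::].

Definition shift k (f : form k.+1) (x : 'I_m) : form k :=
  form_of k (fun s => eval_form f (rcons s x)).

Lemma eval_shift k (f : form k.+1) x s :
  eval_form (shift f x) s = eval_form f (rcons s x).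
Proof.
rewrite eval_form_of; case: eqP => // sk; rewrite eval_form_size // size_rcons.
by apply/eqP => -[].
Qed.

(** The dual of A_k tensor V, for A_k the component of degree k and V the span of the letters: only
    relators followed by at least one letter are imposed. *)
Definition preannihilator k : {set form k.+1} :=
  [set f | [forall x, shift f x \in annihilator k]].

(** A form of degree k+1 can be glued from m forms of degree k, one for each last letter; [rev]
    exposes that letter. *)
Lemma card_preannihilator k : #|annihilator k| ^ m <= #|preannihilator k|.
Proof.
pose glue (c : {ffun 'I_m -> form k}) : form k.+1 := form_of k.+1 (fun s =>
  if rev s is x :: s' then eval_form (c x) (rev s') else 0%R).
have glueK c x : shift (glue c) x = c x.
  apply: eval_formP => s sk.
  by rewrite eval_shift eval_form_of size_rcons sk eqxx rev_rcons revK.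
have glue_inj : injective glue.
  by move=> c c' e; apply/ffunP => x; rewrite -!glueK e.
have <- : #|ffun_on (mem (annihilator k)) : {pred {ffun 'I_m -> _}}| = #|annihilator k| ^ m.
  by rewrite card_ffun_on card_ord.
rewrite -(card_imset _ glue_inj).
apply/subset_leq_card/subsetP => _ /imsetP[c /ffun_onP Hc ->].
by rewrite inE; apply/forallP => x; rewrite glueK.
Qed.

(** Relators in L need testing only at the end of a word: a nonempty right context is already
    handled by the preannihilator. *)
Definition killed_by k (L : seq (free_alg F m)) : {set form k.+1} :=
  [set f in preannihilator k |
     all (fun r => `[< forall u, pairing (fun w => eval_form f (u ++ w)) r = 0%R >]) L].

Lemma killed_byP k L (f : form k.+1) :
  reflect ((forall x, shift f x \in annihilator k) /\
           (forall r u, r \in L -> pairing (fun w => eval_form f (u ++ w)) r = 0%R))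
    (f \in killed_by k L).
Proof.
rewrite inE [f \in preannihilator k]inE; apply: (iffP andP) => -[].
  by move=> /forallP Hx /allP HL; split=> // r u /HL /asboolP.
by move=> Hx HL; split; [apply/forallP | apply/allP => r rL; apply/asboolP => u; apply: HL].
Qed.

Lemma shiftB k (f g : form k.+1) x : (shift (f - g) x = shift f x - shift g x)%R.
Proof. by apply: eval_formP => s _; rewrite eval_formB !eval_shift eval_formB. Qed.

Lemma pairing_evalB k (f g : form k) u v p :
  (pairing (fun w => eval_form (f - g) (u ++ w ++ v)) p =
   pairing (fun w => eval_form f (u ++ w ++ v)) p -
   pairing (fun w => eval_form g (u ++ w ++ v)) p)%R.
Proof. by rewrite -pairing_subfun; apply: eq_pairing => w _; rewrite eval_formB. Qed.

(* For f in the preannihilator, u |-> <f, u r> annihilates all relators: in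
   <f, u r' v r> the last letter of v r can be split off. So imposing r costs a
   factor of at most the size of an annihilator in lower degree. *)
Lemma card_killed_by_cons k L j r : r \in rels j -> 0 < j ->
  #|killed_by k L| <= #|killed_by k (r :: L)| * #|annihilator (k.+1 - j)|.
Proof.
move=> rj j0.
pose restrict (f : form k.+1) : form (k.+1 - j) :=
  form_of (k.+1 - j) (fun u => pairing (fun w => eval_form f (u ++ w)) r).
apply: (@card_fibers _ _ (killed_by k L) _ _ restrict (fun f g : form k.+1 => (f - g)%R)).
- move=> f /killed_byP[Hshift _]; apply/annihilatorP => i q u v qi.
  have [size_uiv|] := eqVneq (size u + i + size v) (k.+1 - j); last first.
    exact: pairing_mismatch.
  pose F2 w w0 := eval_form f (u ++ w ++ v ++ w0).
  have -> : pairing (fun w => eval_form (restrict f) (u ++ w ++ v)) q =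
            pairing (fun w => pairing (F2 w) r) q.
    apply: eq_pairing => w /(rels_homogeneous qi) size_w.
    rewrite eval_form_of !size_cat size_w addnA size_uiv eqxx.
    by apply: eq_pairing => w0 _; rewrite -!catA.
  rewrite pairing_exchange; apply: pairing_eq0 => w0 /(rels_homogeneous rj) size_w0.
  rewrite /F2; case/lastP: {w0}(w0 : word) size_w0 j0 => [<- //|s x _ _].
  move/annihilatorP: (Hshift x) => /(_ i q u (v ++ s) qi) <-.
  by apply: eq_pairing => w _; rewrite eval_shift -!rcons_cat.
- by move=> f; apply: addIr.
move=> f g /killed_byP[fsh fL] /killed_byP[gsh gL] efg; apply/killed_byP; split.
  by move=> x; rewrite shiftB annihilatorB.
move=> q u; rewrite (@eq_pairing _ (fun w => eval_form (f - g)%R (u ++ w ++ [::]))); last first.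
  by move=> w _; rewrite cats0.
have evalE (l : form k.+1) p : pairing (fun w => eval_form l (u ++ w ++ [::])) p =
    pairing (fun w => eval_form l (u ++ w)) p.
  by apply: eq_pairing => w _; rewrite cats0.
rewrite inE => /orP[/eqP->|qL]; last first.
  by rewrite pairing_evalB !evalE fL ?gL ?subrr.
have [size_u|neq] := eqVneq (size u + j) k.+1; last first.
  by apply: (pairing_mismatch _ rj); rewrite addn0.
have := congr1 (fun l => eval_form l u) efg.
rewrite !eval_form_of.
have -> : size u = k.+1 - j by rewrite -size_u addnK.
rewrite eqxx pairing_evalB !evalE => ->.
exact: subrr.
Qed.

Lemma annihilator_killed_by k L :
    (forall j r, 0 < j <= k.+1 -> r \in rels j -> r \in L) ->
  killed_by k L \subset annihilator k.+1.
Proof.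
move=> HL; apply/subsetP => f /killed_byP[fsh fL]; apply/annihilatorP.
move=> j r u v rj; case/lastP: v => [|v x].
  have [size_u|neq] := eqVneq (size u + j) k.+1; last first.
    by apply: (pairing_mismatch _ rj); rewrite addn0.
  rewrite -(fL r u).
    by apply: eq_pairing => w _; rewrite cats0.
  apply: (HL j) (rj); rewrite -size_u leq_addl andbT lt0n.
  by apply: contraTneq rj => ->; rewrite rels0.
move/annihilatorP: (fsh x) => /(_ j r u v rj) <-.
by apply: eq_pairing => w _; rewrite eval_shift -!rcons_cat.
Qed.

(** In terms of dimensions a_k and numbers s_j of relators: a_(k+1) >= m a_k - sum of s_(j+1)
    a_(k-j). The relators of degree at most k+1 are imposed one by one on the preannihilator. *)
Lemma card_annihilator_step k :
  #|annihilator k| ^ m <= #|annihilator k.+1| *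
    \prod_(j < k.+1) #|annihilator (k - j)| ^ size (rels j.+1).
Proof.
pose L := [seq (j, r) | j <- iota 0 k.+1, r <- rels j.+1].
have HL L' : {subset L' <= L} -> #|preannihilator k| <=
    #|killed_by k (map snd L')| * \prod_(x <- L') #|annihilator (k - x.1)|.
  elim: L' => [_|[j r] L' IH sub].
    by rewrite big_nil muln1 subset_leq_card //; apply/subsetP => f; rewrite !inE andbT.
  have /allpairsPdep[i [q [_ qi [ej er]]]] := sub (j, r) (mem_head _ _).
  rewrite big_cons mulnA; apply: leq_trans (IH _) _.
    by move=> x xL; apply: sub; rewrite inE xL orbT.
  subst i q; rewrite leq_mul2r -subSS; apply/orP; right.
  exact: card_killed_by_cons.
apply: leq_trans (card_preannihilator k) _; apply: leq_trans (HL L _) _ => //.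
apply: leq_mul.
  apply/subset_leq_card/annihilator_killed_by => -[//|j] r /andP[_ jk] rj.
  apply/mapP; exists (j, r) => //; apply/allpairsPdep; exists j, r.
  by rewrite mem_iota.
rewrite big_allpairs_dep -[iota 0 k.+1]/(index_iota 0 k.+1) big_mkord.
by apply/eq_leq/eq_bigr => j _; rewrite /= big_const_seq count_predT iter_muln_1.
Qed.

(* Divided by 2^k, this bounds the sum of 2^(-j) over the relators of degree
   j.+1 <= k.+1 by m - 2, so that dimensions at least double. *)
Hypothesis budget : forall k,
  \sum_(j < k.+1) size (rels j.+1) * 2 ^ (k - j) <= (m - 2) * 2 ^ k.
Hypothesis two_le_m : 1 < m.

Lemma card_annihilator_gt0 k : 0 < #|annihilator k|.
Proof. by apply/card_gt0P; exists 0%R; apply: annihilator0. Qed.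

Lemma card_annihilator_double k : #|annihilator k| ^ 2 <= #|annihilator k.+1|.
Proof.
exact: (@doubling (fun i => #|annihilator i|) (fun j => size (rels j.+1)) m)
  two_le_m card_annihilator_gt0 card_annihilator_step budget k.
Qed.

Lemma card_annihilator_gt1 k : 1 < #|annihilator k|.
Proof.
elim: k => [|k IH]; last first.
  apply: leq_trans IH (leq_trans _ (card_annihilator_double k)).
  by rewrite -mulnn leq_pmulr // card_annihilator_gt0.
have -> : annihilator 0 = setT.
  apply/setP => f; rewrite [in RHS]inE; apply/annihilatorP => j r u v rj.
  apply: (pairing_mismatch _ rj); case: j rj => [|j _]; first by rewrite rels0.
  by rewrite addnS.
rewrite cardsT card_ffun card_tuple expn0 expn1.
exact: card_finNzRing_gt1.
Qed.

(** A nonzero form in the annihilator is nonzero at some word w, and it kills the ideal. Terms of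
    other degrees are allowed in p so that differences of words of distinct lengths are covered
    too. *)
Lemma word_notin_ideal (R : free_alg F m -> Prop) k :
    (forall p, R p -> p = 0%R \/ exists j, p \in rels j) ->
  exists2 w : {fmonom 'I_m}, fdeg w = k &
    forall p, ideal_generated R p ->
      (forall v : {fmonom 'I_m}, p@_v != 0%R -> v = w \/ fdeg v <> k) -> p@_w = 0%R.
Proof.
move=> HR; have /card_gt1P[f [g [fA gA neq_fg]]] := card_annihilator_gt1 k.
have hA := annihilatorB fA gA; set h := (f - g)%R in hA.
have [w size_w hw] : exists2 w, size w = k & eval_form h w != 0%R.
  apply/not_exists2P => H; case/negP: neq_fg; rewrite -subr_eq0; apply/eqP.
  apply: eval_formP => s size_s; rewrite eval_form0.
  by have [/(_ size_s)|/negP/negPn/eqP] := H s.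
exists (FMonom w) => // p Ip Hp; have := pairing_ideal hA HR Ip [::] [::].
rewrite (@eq_pairing _ (fun v => (v == w)%:R * eval_form h w)%R); last first.
  move=> v /Hp[->|/eqP neq]; rewrite cats0 /=; first by rewrite eqxx mul1r.
  rewrite eval_form_size //; have [vw|_] := eqVneq (v : word) w; last by rewrite mul0r.
  by rewrite /fdeg vw size_w eqxx in neq.
rewrite pairing_delta => /eqP; rewrite mulf_eq0 (negbTE hw) orbF.
by move/eqP.
Qed.

End GolodShafarevich.

(** * Quotients of the free algebra *)

Section Quotients.

Variables (F : finFieldType) (m : nat).
Local Notation E := (free_alg F m).
Local Open Scope ring_scope.

(** Properness is included because the ring structure of the quotient demands 1 != 0. *)
Record proper_ideal := ProperIdeal {
  ideal_pred :> E -> Prop;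
  proper_ideal0 : ideal_pred 0;
  proper_idealD : forall p q, ideal_pred p -> ideal_pred q -> ideal_pred (p + q);
  proper_idealMl : forall p q, ideal_pred q -> ideal_pred (p * q);
  proper_idealMr : forall p q, ideal_pred p -> ideal_pred (p * q);
  proper_ideal1 : ~ ideal_pred 1 }.

Lemma free_alg_scalerAr (c : F) (p q : E) : c *: (p * q) = p * (c *: q).
Proof.
rewrite -[in RHS]mul_malgC mulrA scalerAl; congr (_ * _).
elim/free_alg_ind: p => [|p p' IH IH'|d w].
- by rewrite scaler0 mul0r.
- by rewrite scalerDr mulrDl; congr (_ + _); [exact: IH | exact: IH'].
by rewrite -mul_malgC !monalgM mulm1 mul1m mulrC.
Qed.

Section Quotient.

Variable I : proper_ideal.

Lemma proper_idealN p : I p -> I (- p).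
Proof. by rewrite -mulN1r; apply: proper_idealMl. Qed.

(** Membership in the ideal is a mere proposition; [asbool] turns it classically into the boolean
    relation that the quotient construction takes. *)
Definition ideal_rel : rel E := fun p q => `[< I (p - q) >].

Lemma ideal_rel_refl : reflexive ideal_rel.
Proof. by move=> p; apply/asboolP; rewrite subrr; apply: proper_ideal0. Qed.

Lemma ideal_rel_sym : symmetric ideal_rel.
Proof. by move=> p q; apply/asboolP/asboolP => /proper_idealN; rewrite opprB. Qed.

Lemma ideal_rel_trans : transitive ideal_rel.
Proof.
move=> q p r /asboolP pq /asboolP qr; apply/asboolP.
by have := proper_idealD pq qr; rewrite addrA subrK.
Qed.

Canonical ideal_equiv := EquivRel ideal_rel ideal_rel_refl ideal_rel_sym ideal_rel_trans.

Definition quotient_alg : Type := {eq_quot ideal_equiv}%qT.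

HB.instance Definition _ := Choice.on quotient_alg.

Definition class (p : E) : quotient_alg := (\pi_({eq_quot ideal_equiv}) p)%qT.
Definition rep (x : quotient_alg) : E := (repr (x : {eq_quot ideal_equiv}))%qT.

Lemma repK : cancel rep class.
Proof. by move=> x; apply: reprK. Qed.

Lemma classP p q : class p = class q <-> I (p - q).
Proof.
split=> [e|H].
  by apply/asboolP; rewrite -[`[< _ >]]/(ideal_equiv p q) -eqmodE; apply/eqP.
by apply/eqP; rewrite eqmodE; apply/asboolP.
Qed.

Lemma rep_class p : I (rep (class p) - p).
Proof. by apply/classP; rewrite repK. Qed.

Let add x y := class (rep x + rep y).
Let opp x := class (- rep x).
Let mul x y := class (rep x * rep y).
Let scale c x := class (c *: rep x).

Lemma class_add p q : add (class p) (class q) = class (p + q).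
Proof.
by apply/classP; rewrite opprD addrACA; apply: proper_idealD; apply: rep_class.
Qed.

Lemma class_opp p : opp (class p) = class (- p).
Proof. by apply/classP; rewrite -opprD; apply/proper_idealN/rep_class. Qed.

Lemma class_mul p q : mul (class p) (class q) = class (p * q).
Proof.
apply/classP; set p' := rep _; set q' := rep _.
have -> : p' * q' - p * q = p' * (q' - q) + (p' - p) * q.
  by rewrite mulrBr mulrBl addrA subrK.
by apply: proper_idealD; [apply: proper_idealMl | apply: proper_idealMr]; apply: rep_class.
Qed.

Lemma class_scale c p : scale c (class p) = class (c *: p).
Proof.
apply/classP; rewrite -scalerBr -mul_malgC; apply: proper_idealMl.
exact: rep_class.
Qed.

Let class_ind (P : quotient_alg -> Prop) : (forall p, P (class p)) -> forall x, P x.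
Proof. by move=> HP x; rewrite -(repK x). Qed.

Fact quotient_addA : associative add.
Proof.
by elim/class_ind=> p; elim/class_ind=> q; elim/class_ind=> r;
  rewrite !class_add addrA.
Qed.

Fact quotient_addC : commutative add.
Proof. by elim/class_ind=> p; elim/class_ind=> q; rewrite !class_add addrC. Qed.

Fact quotient_add0 : left_id (class 0) add.
Proof. by elim/class_ind=> p; rewrite class_add add0r. Qed.

Fact quotient_addN : left_inverse (class 0) opp add.
Proof. by elim/class_ind=> p; rewrite class_opp class_add addNr. Qed.

HB.instance Definition _ := GRing.isZmodule.Build quotient_alg
  quotient_addA quotient_addC quotient_add0 quotient_addN.

Lemma class0 : class 0 = 0. Proof. by []. Qed.

Lemma classD p q : class (p + q) = class p + class q.
Proof. by rewrite -class_add. Qed.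

Fact quotient_mulA : associative mul.
Proof.
by elim/class_ind=> p; elim/class_ind=> q; elim/class_ind=> r;
  rewrite !class_mul mulrA.
Qed.

Fact quotient_mul1 : left_id (class 1) mul.
Proof. by elim/class_ind=> p; rewrite class_mul mul1r. Qed.

Fact quotient_mulr1 : right_id (class 1) mul.
Proof. by elim/class_ind=> p; rewrite class_mul mulr1. Qed.

Fact quotient_mulDl : left_distributive mul +%R.
Proof.
by elim/class_ind=> p; elim/class_ind=> q; elim/class_ind=> r;
  rewrite -classD !class_mul -classD mulrDl.
Qed.

Fact quotient_mulDr : right_distributive mul +%R.
Proof.
by elim/class_ind=> p; elim/class_ind=> q; elim/class_ind=> r;
  rewrite -classD !class_mul -classD mulrDr.
Qed.

Fact quotient_1neq0 : class 1 != 0.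
Proof. by apply/eqP => /classP; rewrite subr0; apply: proper_ideal1. Qed.

HB.instance Definition _ := GRing.Zmodule_isNzRing.Build quotient_alg
  quotient_mulA quotient_mul1 quotient_mulr1 quotient_mulDl quotient_mulDr quotient_1neq0.

Fact quotient_scaleA c d x : scale c (scale d x) = scale (c * d) x.
Proof. by elim/class_ind: x => p; rewrite !class_scale scalerA. Qed.

Fact quotient_scale1 : left_id 1 scale.
Proof. by elim/class_ind=> p; rewrite class_scale scale1r. Qed.

Fact quotient_scaleDr : right_distributive scale +%R.
Proof.
by move=> c; elim/class_ind=> p; elim/class_ind=> q;
  rewrite -classD !class_scale -classD scalerDr.
Qed.

Fact quotient_scaleDl x : {morph scale^~ x : c d / c + d}.
Proof.
by elim/class_ind: x => p c d; rewrite !class_scale -classD scalerDl.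
Qed.

HB.instance Definition _ := GRing.Zmodule_isLmodule.Build F quotient_alg
  quotient_scaleA quotient_scale1 quotient_scaleDr quotient_scaleDl.

Fact quotient_scaleAl (c : F) (x y : quotient_alg) : c *: (x * y) = (c *: x) * y.
Proof.
elim/class_ind: x => p; elim/class_ind: y => q.
by rewrite /GRing.scale /GRing.mul /= class_mul !class_scale class_mul scalerAl.
Qed.

HB.instance Definition _ := GRing.Lmodule_isLalgebra.Build F quotient_alg
  quotient_scaleAl.

Fact quotient_scaleAr (c : F) (x y : quotient_alg) : c *: (x * y) = x * (c *: y).
Proof.
elim/class_ind: x => p; elim/class_ind: y => q.
rewrite /GRing.scale /GRing.mul /= class_mul !class_scale class_mul.
by rewrite free_alg_scalerAr.
Qed.

HB.instance Definition _ := GRing.Lalgebra_isAlgebra.Build F quotient_alg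
  quotient_scaleAr.

Fact class_is_linear : linear class.
Proof. by move=> c p q; rewrite classD -class_scale. Qed.

Fact class_is_monoid_morphism : monoid_morphism class.
Proof. split=> [//|p q]; exact/esym/class_mul. Qed.

HB.instance Definition _ := GRing.isLinear.Build F E quotient_alg *:%R class class_is_linear.
HB.instance Definition _ := GRing.isMonoidMorphism.Build E quotient_alg class
  class_is_monoid_morphism.

Lemma class_eq0 p : class p = 0 <-> I p.
Proof. by rewrite -class0 classP subr0. Qed.

End Quotient.

(** * Maps between quotients, and finite quotients *)

Section Induced.

Variables (I J : proper_ideal).
Hypothesis sIJ : forall p, I p -> J p.

Definition induced of (forall p, I p -> J p) := fun x : quotient_alg I => class J (rep x).

Lemma induced_class p : induced sIJ (class I p) = class J p.
Proof. by apply/classP/sIJ/rep_class. Qed.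

Fact induced_is_linear : linear (induced sIJ).
Proof.
move=> c x y; rewrite -(repK x) -(repK y) -linearP !induced_class.
by rewrite linearP.
Qed.

Fact induced_is_monoid_morphism : monoid_morphism (induced sIJ).
Proof.
split; first by rewrite -(rmorph1 (class I)) induced_class rmorph1.
by move=> x y; rewrite -(repK x) -(repK y) -rmorphM !induced_class rmorphM.
Qed.

HB.instance Definition _ := GRing.isLinear.Build F (quotient_alg I) (quotient_alg J)
  *:%R (induced sIJ) induced_is_linear.
HB.instance Definition _ := GRing.isMonoidMorphism.Build (quotient_alg I) (quotient_alg J)
  (induced sIJ) induced_is_monoid_morphism.

End Induced.

Section Finite.

Variables (J : proper_ideal) (T : finType) (f : quotient_alg J -> T)
  (g : T -> quotient_alg J).

(** An alias that mentions the cancellation proof, so that the finite structure derived from it can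
    be attached to the type. *)
Definition finite_quotient of cancel f g := quotient_alg J.

Hypothesis fK : cancel f g.
Local Notation Q := (finite_quotient fK).

HB.instance Definition _ := GRing.Algebra.on Q.
HB.instance Definition _ : isCountable Q := CanIsCountable fK.
HB.instance Definition _ : isFinite Q := @CanIsFinite Q T f g fK.

End Finite.

End Quotients.

(** * The relators *)

Lemma recursively_enumerable_search (F : finFieldType) m (test : nat -> pred nat)
    (out : nat -> nat -> nat) :
    computable (fun z => test (nleft z) (nright z)) ->
    computable (fun z => out (nleft z) (nright z)) ->
  recursively_enumerable (fun p : free_alg F m => exists x s,
    [/\ test x s, forall j, j < s -> ~~ test x j & p = decode_poly F m (out x s)]).
Proof.
move=> /computable_negb[ct ctP] [co coP].
have ctE x s : outputs ct (npair x s) (~~ test x s).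
  by have := ctP (npair x s); rewrite nleftK nrightK.
have coE x s : outputs co (npair x s) (out x s).
  by have := coP (npair x s); rewrite nleftK nrightK.
have [ci ciP] := computable_id.
(* [PMu] looks for a zero, hence the negated test: it is 0 at the first success and 1 = 0.+1
   before. *)
exists (PComp co (PPair ci (PMu ct))) => p; split.
  move=> [x [s [ts least ->]]]; exists x, (out x s); split=> //.
  apply: outputs_comp (coE x s); apply: outputs_pair (ciP x) _.
  apply: (@outputs_mu _ _ _ (fun=> 0)); last by have := ctE x s; rewrite ts.
  by move=> j /least ntj; have := ctE x j; rewrite ntj.
move=> [x [y [Hc <-]]].
inversion Hc as [| | | | |? ? ? z ? Hz Hy| | |]; subst.
inversion Hz as [| | | |? ? ? x' s Hx' Hs| | | |]; subst.
inversion Hs as [| | | | | | | |? ? ? v Hv Hsv]; subst.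
have ex := outputs_functional (ciP x) Hx'; rewrite /= in ex; subst x'.
rewrite (outputs_functional Hy (coE x s)).
exists x, s; split=> // [|j /Hv Hj].
  by have := outputs_functional Hsv (ctE x s); case: (test _ _).
by have := outputs_functional Hj (ctE x j); case: (test _ _).
Qed.

(* A bound on the indices npair (npair e n) l of the coordinates l < n; since the
   relators of index t start in a degree greater than t, there are at most k of
   them in degree k. *)
Definition level (e n : nat) : nat :=
  foldr (fun l r => npair (npair e n) l + r) 1 (iota 0 n).

Lemma lt_level e n l : l < n -> npair (npair e n) l < level e n.
Proof.
move=> lt_ln; have: l \in iota 0 n by rewrite mem_iota.
rewrite /level; elim: (iota 0 n) => //= h s IH.
rewrite inE => /orP[/eqP->|/IH]; last by move=> /leq_trans; apply; apply: leq_addl.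
rewrite -[X in X < _]addn0 ltn_add2l; elim: s {IH} => //= k s IH.
by rewrite addn_gt0 IH orbT.
Qed.

Section Relators.

Variables (F : finFieldType) (m : nat).
Local Notation E := (free_alg F m).

(** A candidate s codes ((i, j), ((y, z), certificate)), where y and z are claimed to be the outputs
    on i and j. *)
Definition collision_index1 s := nleft (nleft s).
Definition collision_index2 s := nright (nleft s).
Definition collision_value1 s := nleft (nleft (nright s)).
Definition collision_value2 s := nright (nleft (nright s)).
Definition collision_runs s := decode_seq (nright (nright s)).

Definition difference (s l : nat) : nat :=
  sub_code F (nth 0 (decode_seq (collision_value1 s)) l)
             (nth 0 (decode_seq (collision_value2 s)) l).

Definition collision (e n s : nat) : bool :=
  [&& collision_index1 s != collision_index2 s,
      certificate (collision_runs s),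
      run e (collision_index1 s) (collision_value1 s) \in collision_runs s,
      run e (collision_index2 s) (collision_value2 s) \in collision_runs s
    & all (fun l => vanishes_below F m (level e n) (difference s l)) (iota 0 n)].

(** A letter out of range gives the zero polynomial, a harmless relator. *)
Definition power_code (a : nat) : nat :=
  if a < m
  then encode_seq [:: npair (coef_index (1%R : F)) (encode_seq [:: a; a; a; a])]
  else 0.

(** The index t codes ((e, n), l); the first condition says that l is a coordinate, l < n. *)
Definition relevant (t s : nat) : bool :=
  (nright t < nright (nleft t)) && collision (nleft (nleft t)) (nright (nleft t)) s.

(* The inputs of the enumeration of the relators are npair 0 a, for the power of
   the letter a, and npair k'.+1 (npair t k), for the component of degree k of the
   relator of index t. In the first case the search must succeed at once, since
   programmes are strict. *)
Definition test (x s : nat) : bool :=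
  (nleft x == 0) || relevant (nleft (nright x)) s.

Definition relator (x s : nat) : nat :=
  if nleft x == 0 then power_code (nright x)
  else component_code m (nright (nright x)) (difference s (nright (nleft (nright x)))).

Definition relators (p : E) : Prop :=
  exists x s, [/\ test x s, forall j, j < s -> ~~ test x j
                & p = decode_poly F m (relator x s)].

Lemma recursively_enumerable_relators : recursively_enumerable relators.
Proof.
apply: (@recursively_enumerable_search F m test relator).
  have Hc : computable (fun x => certificate (decode_seq x)).
    exact/computable_certificate/computable_decode_seq/computable_id.
  rewrite /test /relevant /collision /vanishes_below /level /difference /sub_code /coef_code
    /is_zero_code /add_code /opp_code /clamp /letters /run /collision_runs
    /collision_index1 /collision_index2 /collision_value1 /collision_value2.
  computability.
  apply: (computable_comp Hc); computability.
rewrite /relator /power_code /component_code /difference /sub_code /opp_code /clamp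
  /letters /collision_value1 /collision_value2.
computability.
Qed.

End Relators.

(** A classical name for the result of the search, with the junk value 0 if there is none; it is
    used in proofs only, never in a programme. *)
Definition least (P : pred nat) : nat :=
  if pselect (exists s, P s) is left h then ex_minn h else 0.

Lemma least_eq (P : pred nat) s : P s -> (forall j, j < s -> ~~ P j) -> least P = s.
Proof.
move=> Ps Hlt; rewrite /least; case: pselect => [h|[]]; last by exists s.
case: ex_minnP => k Pk kmin; apply/eqP; rewrite eqn_leq kmin //= leqNgt.
by apply/negP => /Hlt; rewrite Pk.
Qed.

Lemma least_spec (P : pred nat) : (exists s, P s) ->
  P (least P) /\ forall j, j < least P -> ~~ P j.
Proof.
rewrite /least => h; case: pselect => // h'; case: ex_minnP => k Pk kmin.
by split=> // j; rewrite ltnNge; apply: contra => /kmin.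
Qed.

(** * Counting the relators degree by degree *)

Section RelatorCount.

Variables (F : finFieldType) (m : nat).
Local Notation E := (free_alg F m).

Lemma degree_part_homogeneous k (p : E) (w : {fmonom 'I_m}) :
  (degree_part (pred1 k) p)@_w != 0%R -> fdeg w = k.
Proof. by rewrite mcoeff_degree_part /=; case: (fdeg w =P k) => // _; rewrite eqxx. Qed.

(** Defined for every t, even if the search for t fails: surplus entries only enlarge the list for
    which the count is carried out. *)
Definition relator_at (t k : nat) : E :=
  degree_part (pred1 k) (decode_poly F m (difference F (least (relevant F m t)) (nright t))).

Definition power (i : 'I_m) : E := (<< 1 *g FMonom [:: i; i; i; i] >>)%R.

Definition relator_list (k : nat) : seq E :=
  [seq relator_at t k | t <- iota 0 k] ++
  (if k == 4 then [seq power i | i <- enum 'I_m] else [::]).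

Lemma relator_list0 : relator_list 0 = [::].
Proof. by []. Qed.

Lemma size_relator_list k : size (relator_list k) = k + (if k == 4 then m else 0).
Proof.
rewrite size_cat size_map size_iota; case: eqP => // _.
by rewrite size_map size_enum_ord.
Qed.

Lemma relator_list_homogeneous k r (w : {fmonom 'I_m}) :
  r \in relator_list k -> r@_w != 0%R -> size w = k.
Proof.
rewrite mem_cat => /orP[/mapP[t _ ->]|]; first exact: degree_part_homogeneous.
case: eqP => // -> /mapP[i _ ->]; rewrite mcoeffU.
by case: (_ =P w) => [<- //|_]; rewrite eqxx.
Qed.

Lemma decode_poly0 : decode_poly F m 0 = 0%R.
Proof. exact: big_nil. Qed.

Lemma power_codeE a : decode_poly F m (power_code F m a) =
  if insub a is Some i then power i else 0%R.
Proof.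
rewrite /power_code; case: insubP => [i am ai|/negbTE ->]; last exact: decode_poly0.
rewrite am /decode_poly encode_seqK big_seq1 nleftK nrightK coef_indexK.
congr (<< _ *g _ >>)%R; apply/eqP; rewrite fmP /decode_word encode_seqK /= -ai.
by rewrite valK.
Qed.

(** A component of degree k of the relator t either has t < k and is listed, or has k <= t, which is
    below the level up to which the difference vanishes, and is 0. *)
Lemma relator_spec p : relators p -> p = 0%R \/ exists k, p \in relator_list k.
Proof.
case=> x [s [Ht Hmin ->]]; rewrite /relator; case: eqP => [_|x0].
  rewrite power_codeE; case: insubP => [i _ _|_]; last by left.
  by right; exists 4; rewrite mem_cat orbC map_f ?mem_enum.
move: Ht Hmin; rewrite /test (introF eqP x0) /=.
set t := nleft (nright x); set k := nright (nright x) => Ht Hmin.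
rewrite component_codeE -(least_eq Ht Hmin).
have [lt_tk|le_kt] := ltnP t k.
  right; exists k; rewrite mem_cat; apply/orP; left; apply/mapP.
  by exists t; rewrite // mem_iota.
left; apply/malgP => w; rewrite mcoeff_degree_part mcoeff0 /=.
case: eqP => // wk; rewrite (least_eq Ht Hmin).
case/andP: Ht => ln /and5P[_ _ _ _ /allP Hv].
have /Hv /vanishes_belowP : nright t \in iota 0 (nright (nleft t)) by rewrite mem_iota.
apply; rewrite wk (leq_ltn_trans le_kt) // -{1}(npairK t) -{1}(npairK (nleft t)).
exact: lt_level.
Qed.

Lemma power_relator i : relators (power i).
Proof.
exists (npair 0 i), 0; split=> //; first by rewrite /test nleftK.
by rewrite /relator nleftK /= nrightK power_codeE valK.
Qed.

Lemma component_relator e n l k :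
    l < n -> (exists s, collision F m e n s) ->
  relators (degree_part (pred1 k)
    (decode_poly F m (difference F (least (collision F m e n)) l))).
Proof.
move=> lt_ln Hs; have [Hc Hmin] := least_spec Hs.
exists (npair 1 (npair (npair (npair e n) l) k)), (least (collision F m e n)).
rewrite /test /relevant /relator !(nleftK, nrightK) lt_ln /= component_codeE.
by split.
Qed.

End RelatorCount.

Lemma relator_budget F k :
  \sum_(j < k.+1) size (@relator_list F 8 j.+1) * 2 ^ (k - j) <= (8 - 2) * 2 ^ k.
Proof.
under eq_bigr do rewrite size_relator_list.
pose r j := j.+1 + (if j.+1 == 4 then 8 else 0).
pose S k := \sum_(j < k.+1) r j * 2 ^ (k - j); rewrite -/(S k).
have S_succ i : S i.+1 = 2 * S i + r i.+1.
  rewrite /S big_ord_recr /= subnn expn0 muln1; congr (_ + _).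
  rewrite big_distrr /=; apply: eq_bigr => j _.
  by rewrite mulnCA -expnS -subSn // -ltnS.
(* Without the powers, S k = 4 * 2^k - k - 3 exactly. The eight powers of degree 4 enter at j = 3
   and add 8 * 2^(k-3) = 2^k from k = 3 on. *)
suff : S k + k + 3 <= 4 * 2 ^ k + (2 < k) * 2 ^ k.
  move=> H; apply: leq_trans (leq_trans _ H) _; first by rewrite -addnA leq_addr.
  by rewrite -mulnDl leq_mul2r; case: (2 < k); rewrite orbT.
elim: k => [|k IH]; first by rewrite /S big_ord1.
rewrite S_succ /r; have [k2|k2] := eqVneq k 2.
  by move: IH; rewrite k2 /=; lia.
have -> : (k.+2 == 4) = false by rewrite !eqSS; apply/negbTE.
rewrite !expnS; move: IH; case: (ltnP 2 k) => hk; case: (ltnP 2 k.+1) => hk'; lia.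
Qed.

(** * Homogeneous ideals *)

Section IdealGenerated.

Variables (F : finFieldType) (m : nat) (R : free_alg F m -> Prop).
Local Notation E := (free_alg F m).
Local Open Scope ring_scope.

Lemma degree_part_mulU d c (w : {fmonom 'I_m}) (q : E) :
  degree_part (ltn^~ d) (<< c *g w >> * q) =
  << c *g w >> * degree_part (ltn^~ (d - fdeg w)%N) q.
Proof.
elim/free_alg_ind: q => [|q q' IH IH'|a v].
- by rewrite mulr0 !degree_part0 mulr0.
- rewrite mulrDr [in LHS]degree_partD [in RHS]degree_partD mulrDr.
  by congr (_ + _); [exact: IH | exact: IH'].
rewrite monalgM !degree_partU /= fdegM ltn_subRL.
by case: ifP; rewrite ?mulr0 // monalgM.
Qed.

Lemma degree_part_mulrU d c (w : {fmonom 'I_m}) (q : E) :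
  degree_part (ltn^~ d) (q * << c *g w >>) =
  degree_part (ltn^~ (d - fdeg w)%N) q * << c *g w >>.
Proof.
elim/free_alg_ind: q => [|q q' IH IH'|a v].
- by rewrite mul0r !degree_part0 mul0r.
- rewrite mulrDl [in LHS]degree_partD [in RHS]degree_partD mulrDl.
  by congr (_ + _); [exact: IH | exact: IH'].
rewrite monalgM !degree_partU /= fdegM ltn_subRL addnC.
by case: ifP; rewrite ?mul0r // monalgM.
Qed.

(** A factor of length l turns truncation at d into truncation at d - l, so all lower truncations of
    q are required. *)
Lemma degree_part_idealMl (I : E -> Prop) d p q :
    I 0 -> (forall p q, I p -> I q -> I (p + q)) -> (forall p q, I q -> I (p * q)) ->
    (forall d', (d' <= d)%N -> I (degree_part (ltn^~ d') q)) ->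
  I (degree_part (ltn^~ d) (p * q)).
Proof.
move=> I0 ID IM Iq; elim/free_alg_ind: p => [|p p' IH IH'|c w].
- by rewrite mul0r degree_part0.
- by rewrite mulrDl degree_partD; apply: ID.
by rewrite degree_part_mulU; apply/IM/Iq/leq_subr.
Qed.

Lemma degree_part_idealMr (I : E -> Prop) d p q :
    I 0 -> (forall p q, I p -> I q -> I (p + q)) -> (forall p q, I p -> I (p * q)) ->
    (forall d', (d' <= d)%N -> I (degree_part (ltn^~ d') p)) ->
  I (degree_part (ltn^~ d) (p * q)).
Proof.
move=> I0 ID IM Ip; elim/free_alg_ind: q => [|q q' IH IH'|c w].
- by rewrite mulr0 degree_part0.
- by rewrite mulrDr degree_partD; apply: ID.
by rewrite degree_part_mulrU; apply/IM/Ip/leq_subr.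
Qed.

Hypothesis R_homogeneous : forall p, R p ->
  exists k, forall w : {fmonom 'I_m}, p@_w != 0 -> fdeg w = k.

Lemma ideal_degree_part d p :
  ideal_generated R p -> ideal_generated R (degree_part (ltn^~ d) p).
Proof.
move=> Ip; elim: Ip d => {p} [p Rp d|d|p q _ IHp _ IHq d|p q _ IH d|p q _ IH d].
- have [k pk] := R_homogeneous Rp.
  suff -> : degree_part (ltn^~ d) p = if (k < d)%N then p else 0.
    by case: ifP => _; [apply: ideal_gen | apply: ideal_zero].
  apply/malgP => w; rewrite mcoeff_degree_part (fun_if (fun q => q@_w)) mcoeff0.
  by have [->|/pk ->] := eqVneq (p@_w) 0; rewrite ?if_same.
- by rewrite degree_part0; apply: ideal_zero.
- by rewrite degree_partD; apply: ideal_add.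
- apply: degree_part_idealMl => *; [exact: ideal_zero|exact: ideal_add|exact: ideal_mull|exact: IH].
- apply: degree_part_idealMr => *; [exact: ideal_zero|exact: ideal_add|exact: ideal_mulr|exact: IH].
Qed.

(** This recovers a difference of tuple entries from its components, which are the actual
    relators. *)
Lemma ideal_of_components p :
  (forall k, ideal_generated R (degree_part (pred1 k) p)) -> ideal_generated R p.
Proof.
move=> Ip; pose N := mmeasure (@fdeg 'I_m) p.
have -> : p = \sum_(k < N) degree_part (pred1 (k : nat)) p.
  apply/malgP => w; rewrite raddf_sum /=.
  under eq_bigr do rewrite mcoeff_degree_part /=.
  have [lt_wN|le_Nw] := ltnP (fdeg w) N.
    rewrite (bigD1 (Ordinal lt_wN)) //= eqxx big1 ?addr0 // => k.
    by rewrite -val_eqE /= eq_sym => /negbTE ->.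
  have -> : p@_w = 0 by apply/mcoeff_outdom/(mmeasure_mnm_ge le_Nw).
  by rewrite big1 // => k _; rewrite if_same.
by apply: big_ind => [|q r|k _]; [exact: ideal_zero|exact: ideal_add|exact: Ip].
Qed.

Hypothesis R_proper : ~ ideal_generated R 1.

Definition generated_ideal : proper_ideal F m :=
  ProperIdeal (@ideal_zero F m R) (@ideal_add F m R) (@ideal_mull F m R)
    (@ideal_mulr F m R) R_proper.

Fact truncated_ideal1 d : ~ ideal_generated R (degree_part (ltn^~ d.+1) 1).
Proof. by rewrite degree_partU fdeg1. Qed.

(** The sum of the ideal and all polynomials without terms of degree at most d. Cutting at d.+1
    always keeps the constant term, so the sum stays proper. *)
Definition truncated_ideal (d : nat) : proper_ideal F m.
refine (@ProperIdeal F m (fun p => ideal_generated R (degree_part (ltn^~ d.+1) p))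
  _ _ _ _ (@truncated_ideal1 d)).
- by rewrite degree_part0; apply: ideal_zero.
- by move=> p q Ip Iq; rewrite degree_partD; apply: ideal_add.
- move=> p q Iq; apply: degree_part_idealMl => [||p' q'|d' le_d'd].
  + exact: ideal_zero.
  + exact: ideal_add.
  + exact: ideal_mull.
  suff <- : degree_part (ltn^~ d') (degree_part (ltn^~ d.+1) q) = degree_part (ltn^~ d') q.
    exact: ideal_degree_part.
  apply/malgP => w; rewrite !mcoeff_degree_part.
  by case: ifP => //= lt_wd'; rewrite (leq_trans lt_wd' le_d'd).
move=> p q Ip; apply: degree_part_idealMr => [||p' q'|d' le_d'd].
+ exact: ideal_zero.
+ exact: ideal_add.
+ exact: ideal_mulr.
suff <- : degree_part (ltn^~ d') (degree_part (ltn^~ d.+1) p) = degree_part (ltn^~ d') p.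
  exact: ideal_degree_part.
apply/malgP => w; rewrite !mcoeff_degree_part.
by case: ifP => //= lt_wd'; rewrite (leq_trans lt_wd' le_d'd).
Defined.

Section TruncatedQuotient.

Variable d : nat.
Local Notation Q := (quotient_alg (truncated_ideal d)).

Definition low_coefs (p : E) : {ffun d.-bseq 'I_m -> F} := [ffun s : d.-bseq 'I_m => p@_(FMonom s)].
Definition of_low_coefs (h : {ffun d.-bseq 'I_m -> F}) : Q :=
  class (truncated_ideal d) (\sum_(s : d.-bseq 'I_m) << h s *g FMonom s >>).

(** The finitely many coefficients at words of length at most d determine the class, so the
    truncated quotient is finite. *)
Lemma low_coefsK : cancel (fun x : Q => low_coefs (rep x)) of_low_coefs.
Proof.
move=> x; rewrite -[RHS]repK; apply/classP => /=.
suff -> : degree_part (ltn^~ d.+1)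
    (\sum_(s : d.-bseq 'I_m) << low_coefs (rep x) s *g FMonom s >> - rep x) = 0 by apply: ideal_zero.
apply/malgP => w; rewrite mcoeff_degree_part mcoeff0; case: ifP => // le_wd.
rewrite mcoeffB raddf_sum /= (bigD1 (Bseq (le_wd : (size w <= d)%N))) //= ffunE fmK.
rewrite mcoeffUU big1 ?addr0 ?subrr // => s neq; rewrite mcoeffU.
case: eqP => // sw; case/eqP: neq; apply/val_inj => /=.
by rewrite -sw.
Qed.

End TruncatedQuotient.

Lemma residually_finite_generated : residually_finite (quotient_alg generated_ideal).
Proof.
(* With d bounding the degrees in p, truncation leaves p unchanged, so p lies in the truncated ideal
   only if it lies in the ideal. *)
move=> a a0; pose p := rep a; pose d := mmeasure (@fdeg 'I_m) p.
have sub q : generated_ideal q -> truncated_ideal d q by apply: ideal_degree_part.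
exists (finite_quotient (@low_coefsK d) : finAlgType F), (induced sub).
rewrite -(repK a) /= induced_class; apply: contra_neq a0 => /class_eq0 /= Ip.
rewrite -(repK a); apply/class_eq0 => /=.
suff pE : degree_part (ltn^~ d.+1) p = p by rewrite -/p pE in Ip.
apply/malgP => w; rewrite mcoeff_degree_part /=; case: ltnP => // /ltnW le_dw.
by rewrite (mcoeff_outdom (mmeasure_mnm_ge le_dw)).
Qed.

Lemma subalgebra_generated_letters (a : quotient_alg generated_ideal) :
  subalgebra_generated
    [seq class generated_ideal << 1 *g fmu i >> | i <- enum 'I_m] a.
Proof.
set s := [seq _ | _ <- _]; rewrite -(repK a); elim/free_alg_ind: (rep a) => [|p q IHp IHq|c w].
- by rewrite linear0 -(scale0r 1); apply/subalg_scale/subalg_one.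
- by rewrite linearD; apply: subalg_add.
have -> : << c *g w >> = c *: << 1 *g w >> :> E.
  by rewrite -mul_malgC monalgM mul1m mulr1.
rewrite linearZ; apply: subalg_scale.
rewrite -[w]fmK; elim: (w : seq _) => {w} [|i w IH].
  by rewrite -fmoneE (rmorph1 (class generated_ideal)); apply: subalg_one.
have -> : << 1 *g FMonom (i :: w) >> = << 1 *g fmu i >> * << 1 *g FMonom w >> :> E.
  by rewrite monalgM mulr1; congr << _ *g _ >>; apply/eqP; rewrite fmP fmM fmuE.
rewrite rmorphM; apply: subalg_mul IH; apply: subalg_gen.
by apply: map_f; rewrite mem_enum.
Qed.

End IdealGenerated.

(** * The algebra *)

Section Collisions.

Variables (F : finFieldType) (m : nat).
Local Notation E := (free_alg F m).

Lemma collision_exists (c : program) n (u : nat -> {ffun 'I_n -> E}) :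
    (forall k, exists y, outputs c k y /\ decode_tuple F m n y = u k) ->
  exists s, collision F m (encode_program c) n s.
Proof.
move=> Hu; set e := encode_program c; set d := level e n.
(* Pigeonhole over this finite type; it also records words of length exactly d, slightly more than
   agreement below d asks for. *)
pose T : finType := {ffun 'I_n -> {ffun d.-bseq 'I_m -> F}}.
pose low (k : nat) : T := [ffun i => low_coefs d (u k i)].
have /injectivePn[i [j neq_ij eq_ij]] : ~~ injectiveb (fun k : 'I_(#|T|.+1) => low k).
  by apply/injectiveP => /leq_card; rewrite card_ord ltnn.
have [y [cy uy]] := Hu i; have [z [cz uz]] := Hu j.
have [s Hs ys] := certificate_complete cy.
have [t Ht zt] := certificate_complete cz.
exists (npair (npair i j) (npair (npair y z) (encode_seq (s ++ t)))).
rewrite /collision /difference /collision_runs /collision_index1 /collision_index2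
  /collision_value1 /collision_value2 !(nleftK, nrightK) encode_seqK !mem_cat ys zt orbT.
rewrite val_eqE neq_ij certificate_cat //=; apply/allP => l.
rewrite mem_iota add0n => /= lt_ln; apply/vanishes_belowP => w lt_wd.
rewrite sub_codeE mcoeffB.
have size_w : size w <= d by apply: ltnW.
have := congr1 (fun h : T => h (Ordinal lt_ln) (Bseq size_w)) eq_ij.
by rewrite !ffunE -uy -uz !ffunE /= fmK => ->; rewrite subrr.
Qed.

(** The collision found by the search need not be the one produced by the pigeonhole argument; its
    indices are read off from s. *)
Lemma collision_sound (c : program) n (u : nat -> {ffun 'I_n -> E}) s :
    (forall k, exists y, outputs c k y /\ decode_tuple F m n y = u k) ->
    collision F m (encode_program c) n s ->
  exists i j, i != j /\ forall l : 'I_n,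
    decode_poly F m (difference F s l) = (u i l - u j l)%R.
Proof.
move=> Hu /and5P[neq /certificate_sound Hs /Hs Hi /Hs Hj _].
exists (collision_index1 s), (collision_index2 s); split=> // l.
have [y [cy <-]] := Hu (collision_index1 s).
have [z [cz <-]] := Hu (collision_index2 s).
by rewrite sub_codeE (outputs_functional Hi cy) (outputs_functional Hj cz) !ffunE.
Qed.

End Collisions.

Theorem mainTheorem2 (F : finFieldType) :
  exists (A : algType F) (m : nat) (phi : {lrmorphism free_alg F m -> A}),
    [/\ infinite_algebra A,
        recursive_presentation phi,
        residually_finite A,
        (forall n : nat, (0 < n)%N -> algorithmically_finite_power phi n)
      & exists s : seq A,
          (forall a, a \in s -> nilpotent_elt a) /\
          (forall a, subalgebra_generated s a)].
Proof.
pose R : free_alg F 8 -> Prop := @relators F 8.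
have R_homogeneous p : R p ->
    exists k, forall w : {fmonom 'I_8}, p@_w != 0%R -> fdeg w = k.
  case/relator_spec=> [->|[k pk]]; last first.
    by exists k => w; apply: relator_list_homogeneous pk.
  by exists 0 => w; rewrite mcoeff0 eqxx.
have survivor := @word_notin_ideal F 8 (@relator_list F 8)
  (@relator_list_homogeneous F 8) (relator_list0 F 8) (relator_budget F) isT R _
  (@relator_spec F 8).
have R_proper : ~ ideal_generated R 1%R.
  (* The surviving word of degree 0 is empty, and 1 has no other monomial. *)
  have [w w0 Hw] := survivor 0 => /Hw; rewrite mcoeff1 (fdeg_eq0I w0) eqxx.
  move=> H; suff /eqP : (1%R : F) = 0%R by rewrite oner_eq0.
  apply: H => v; rewrite mcoeff1; have [->|_] := eqVneq v mone; last by rewrite eqxx.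
  by left.
pose I := generated_ideal R_proper.
exists (quotient_alg I), 8, (class I); split.
- case=> s Hs.
  (* One surviving word in each degree; in the difference of two of them, the first is the only term
     of its degree, so their classes differ. *)
  have /choice[w Hw] k : exists w : {fmonom 'I_8}, fdeg w = k /\
      forall p, ideal_generated R p ->
        (forall v : {fmonom 'I_8}, p@_v != 0%R -> v = w \/ fdeg v <> k) -> p@_w = 0%R.
    by have [w] := survivor k; exists w.
  pose a (k : nat) : quotient_alg I := class I (<< 1 *g w k >>)%R.
  have a_inj : injective a.
    move=> i j /classP Iij; apply/eqP/negPn/negP => /eqP neq_ij.
    have neq_w : w j != w i.
      by apply/eqP => /(congr1 (@fdeg _)); rewrite !(Hw _).1 => /esym.
    have := (Hw i).2 _ Iij; rewrite mcoeffB !mcoeffU eqxx (negbTE neq_w) subr0.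
    move=> H; suff /eqP : (1%R : F) = 0%R by rewrite oner_eq0.
    apply: H => v; rewrite mcoeffB !mcoeffU; have [<-|_] := eqVneq (w i) v; first by left.
    have [<- _|_] := eqVneq (w j) v; last by rewrite subrr eqxx.
    by right; rewrite (Hw j).1 => /esym.
  have := @uniq_leq_size _ (map a (iota 0 (size s).+1)) s.
  rewrite map_inj_uniq // iota_uniq size_map size_iota ltnn.
  by move/(_ isT (fun x _ => Hs x)).
- split; first by move=> x; exists (rep x); apply: repK.
  exists R; split; first exact: recursively_enumerable_relators.
  exact: class_eq0.
- exact: residually_finite_generated.
- move=> n n_gt0 [u [[c Hu] u_inj]].
  (* The relators imposed for the code of c and n come from the least collision, so the tuples at
     its two distinct indices have equal images in all coordinates. *)
  have Hs := collision_exists Hu; have [Hc _] := least_spec Hs.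
  have [i [j [neq_ij Hij]]] := collision_sound Hu Hc.
  case/eqP: neq_ij; apply: u_inj; apply/ffunP => l; rewrite !ffunE.
  apply/classP; rewrite -Hij; apply: ideal_of_components => k; apply: ideal_gen.
  exact: component_relator.
exists [seq class I (<< 1 *g fmu i >>)%R | i <- enum 'I_8]; split; last first.
  exact: subalgebra_generated_letters.
move=> _ /mapP[i _ ->]; exists 4; rewrite -rmorphXn; apply/class_eq0/ideal_gen.
have -> : ((<< 1 *g fmu i >> : free_alg F 8) ^+ 4 = power F i)%R.
  rewrite !exprS expr0 mulr1 !monalgM !mulr1; congr (<< _ *g _ >>)%R.
  by apply/eqP; rewrite fmP !fmM !fmuE.
exact: power_relator.
Qed.
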